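(* $\ker\iota_{\tilde\Xi}=\mathfrak{P}^\perp$. In particular, the Stembridge peak algebra $\mathfrak{P}$ is a sub-coalgebra of $(\mathsf{Qsym},\gamma)$, dual to the algebra $(\mathcal{P},\star)$, and $$[\varphi\star\psi,f]=[\varphi\otimes\psi,\gamma(f)]$$ for all $\varphi,\psi\in\mathcal{P}$, $f\in\mathfrak{P}$.
   Context: $K$ is a field of characteristic $0$; $\mathbb{N}$ is the set of positive integers. Permutations act on the right ($i\pi$ is the image of $i$) and products in $S_n$ are read from left to right. For $\pi\in S_n$: $\mathrm{Des}(\pi)=\{i\mid 1\le i\le n-1,\ i\pi>(i+1)\pi\}$ and $\mathrm{Peak}(\pi)=\{i\mid 2\le i\le n-1,\ (i-1)\pi<i\pi>(i+1)\pi\}$. For $D\subseteq\{1,\ldots,n-1\}$ let $\Delta^D=\sum_{\mathrm{Des}(\pi)=D}\pi\in KS_n$ and $\Xi^D=\sum_{E\subseteq D}\Delta^E$; $\mathcal{D}_n$ is the linear span of the $\Delta^D$ and $\mathcal{D}=\bigoplus_{n\ge0}\mathcal{D}_n$. For a word $q=q_1.\cdots.q_k$ in the free monoid $\mathbb{N}^*$ over $\mathbb{N}$, with sum $n=q_1+\cdots+q_k$, put $D(q)=\{q_1,q_1+q_2,\ldots,q_1+\cdots+q_{k-1}\}$, $\Delta^q=\Delta^{D(q)}$, $\Xi^q=\Xi^{D(q)}$. The outer product $\star$ on $\mathcal{D}$ is given by $\Xi^r\star\Xi^q=\Xi^{r.q}$ (concatenation of words). For a set $D$ of integers and an integer $z$,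 $D+z=\{d+z\mid d\in D\}$. A peak set in $\{1,\ldots,n\}$ is a set $P\subseteq\{2,\ldots,n-1\}$ with $P\cap(P-1)=\emptyset$. Put $\Pi^P=\sum_{\mathrm{Peak}(\pi)=P}\pi$ (sum over $\pi\in S_n$); $\mathcal{P}_n$ is the linear span of all $\Pi^P$, $P$ a peak set in $\{1,\ldots,n\}$, and $\mathcal{P}=\bigoplus_{n\ge0}\mathcal{P}_n$, a sub-algebra of $(\mathcal{D},\star)$. Put $\tilde\Xi^n=2\Pi^\emptyset\in\mathcal{P}_n$ for $n\ge1$ and let $\tilde\Xi^0$ be the empty permutation; $\iota_{\tilde\Xi}:\mathcal{D}\to\mathcal{D}$ is the linear map with $\varphi\mapsto\varphi\tilde\Xi^n$ (product in $KS_n$) for $\varphi\in\mathcal{D}_n$, $n\ge0$. $\mathsf{Qsym}$ is the algebra of quasi-symmetric functions over $K$ in commuting variables $x_1,x_2,\ldots$, with monomial basis $M_r=\sum_{i_1<\cdots<i_l}x_{i_1}^{r_1}\cdots x_{i_l}^{r_l}$ ($r=r_1.\cdots.r_l\in\mathbb{N}^*$) and fundamental basis $F_q=\sum_rM_r$, summed over all $r\in\mathbb{N}^*$ with the same sum as $q$ and $D(q)\subseteq D(r)$. For $D\subseteq\{1,\ldots,n-1\}$ write $F_D=F_q$, where $q$ is the composition of $n$ with $D=D(q)$ ($n$ being understood). The outer coproduct $\gamma$ on $\mathsf{Qsym}$ is $\gamma(M_r)=\sum_{r=u.v}M_u\otimes M_v$. The pairing between $\mathcal{D}$ and $\mathsf{Qsym}$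 is given by $\langle\Delta^q,F_s\rangle=1$ if $q=s$ and $0$ if $q\ne s$. For a peak set $P$ in $\{1,\ldots,n\}$ put $$K_P:=\sum_{D\subseteq\{1,\ldots,n-1\},\ P\subseteq D\triangle(D+1)}F_D,$$ where $\triangle$ denotes symmetric difference. The Stembridge peak algebra $\mathfrak{P}$ is the sub-algebra of $\mathsf{Qsym}$ whose $n$-th homogeneous component has as linear basis the elements $K_P$, $P$ a peak set in $\{1,\ldots,n\}$. Put $\mathfrak{P}^\perp:=\{\varphi\in\mathcal{D}\mid\langle\varphi,f\rangle=0\text{ for all }f\in\mathfrak{P}\}$. The pairing $[\cdot,\cdot]$ between $\mathcal{P}$ and $\mathfrak{P}$ is given by $[\Pi^P,K_Q]=1$ if $P=Q$ and $0$ otherwise, for peak sets $P,Q$ in $\{1,\ldots,n\}$, $n\ge0$ (components of different degrees being orthogonal), extended to tensor squares by $[\varphi\otimes\psi,f\otimes g]=[\varphi,f][\psi,g]$.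
   Formalization: The pairing is renormalised to [Π^P, 2^{|P|+1}K_Q]=δ_{P,Q} for n≥1 (unchanged for n=0), since with [Π^P,K_Q]=δ_{P,Q} the identity fails: φ=ψ=Π^∅ in degree 1 and f=K_∅ in degree 2 give 1 on the left and 2 on the right. *)

(* Defs.v *)
(* Mathematical Components, with the set and function layer of MathComp-Analysis
   and the free modules [{malg K[T]}] of multinomials. *)
From HB Require Import structures.
From mathcomp Require Import all_boot all_order all_algebra all_fingroup.
From mathcomp Require Import finmap monalg zify.
From mathcomp Require Import boolp classical_sets functions.

Set Implicit Arguments.
Unset Strict Implicit.
Unset Printing Implicit Defensive.

Import GRing.Theory.

Local Open Scope classical_set_scope.
Local Open Scope ring_scope.

Section LinearAlgebra.

Variable K : fieldType.

Definition lincomb (I : choiceType) (V : lmodType K)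
    (c : {malg K[I]}) (b : I -> V) : V :=
  \sum_(i <- msupp c) c@_i *: b i.

Definition span (V : lmodType K) (A : set V) : set V :=
  [set v | exists s : seq (K * V),
    (forall x, x \in s -> A x.2) /\ v = \sum_(x <- s) x.1 *: x.2].

(* The coordinates of [v] in the linearly independent family [b]; they are 0
   when [v] is not in the span of [b]. *)
Definition coord (I : choiceType) (V : lmodType K) (b : I -> V) (v : V) :
    {malg K[I]} :=
  xget 0 [set c | v = lincomb c b].

(* The linear map from the span of the independent family [b] with values
   [g i] at [b i], and its bilinear analogue. *)
Definition extend (I : choiceType) (V W : lmodType K)
    (b : I -> V) (g : I -> W) (v : V) : W :=
  lincomb (coord b v) g.

Definition extend2 (I J : choiceType) (V W U : lmodType K)
    (b : I -> V) (c : J -> W) (g : I -> J -> U) (v : V) (w : W) : U :=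
  extend b (fun i => extend c (g i) w) v.

Lemma coordK (I : choiceType) (V : lmodType K) (b : I -> V) :
  injective (fun c : {malg K[I]} => lincomb c b) ->
  forall c, coord b (lincomb c b) = c.
Proof.
by move=> inj_b c; apply: xget_unique => // c' /= /esym /inj_b.
Qed.

End LinearAlgebra.

Definition below (n : nat) : {fset nat} := [fset i in index_iota 1 n]%fset.
(* [D + 1] and [D - 1]; the latter is only used for [D] without 0. *)
Definition shiftS (D : {fset nat}) : {fset nat} := [fset d.+1 | d in D]%fset.
Definition shiftP (D : {fset nat}) : {fset nat} := [fset d.-1 | d in D]%fset.
Definition symdiff (D E : {fset nat}) : {fset nat} :=
  ((D `\` E) `|` (E `\` D))%fset.

Definition pos := {n : nat | (0 < n)%N}.

(* The free monoid over the positive integers; its product is [++]. *)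
Definition word := seq pos.

Definition wsum (q : word) : nat := sumn (map val q).

Definition partial_sums (q : word) : {fset nat} :=
  [fset wsum (take i q) | i in index_iota 1 (size q)]%fset.

(* The composition [q] of [n] with [partial_sums q = D]: consecutive differences
   of 0, the elements of [D] in increasing order, and [n]. For [n = 0] the
   single difference 0 is dropped, which gives the empty word. *)
Definition comp_of (n : nat) (D : {fset nat}) : word :=
  pmap insub (pairmap (fun a b => (b - a)%N) 0%N (rcons (sort leq D) n)).

Definition compositions (n : nat) : seq word :=
  [seq comp_of n D | D <- fpowerset (below n)].

Section Compositions.

Local Open Scope nat_scope.

Lemma mem_below n i : (i \in below n) = (0 < i < n).
Proof. by rewrite /below in_fset /= mem_index_iota. Qed.

Lemma sumn_take_diff a s i : path ltn a s -> i <= size s ->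
  a + sumn (take i (pairmap (fun a b => b - a) a s)) = nth 0 (a :: s) i.
Proof.
elim: s a i => [|b s IHs] a [|i] //=; rewrite ?addn0 //.
case/andP=> ltab ps le_i; rewrite addnA subnKC ?(ltnW ltab) //.
by rewrite IHs //; case: i le_i.
Qed.

Lemma diff_pos a s : path ltn a s ->
  map val (pmap insub (pairmap (fun a b => b - a) a s) : word)
    = pairmap (fun a b => b - a) a s.
Proof.
elim: s a => //= b s IHs a /andP[ltab ps].
by rewrite insubT ?subn_gt0 //= => ?; rewrite IHs.
Qed.

Lemma path_below n (D : {fset nat}) : (D `<=` below n)%fset -> 0 < n ->
  path ltn 0 (rcons (sort leq D) n).
Proof.
move=> sDn n_gt0; rewrite (@path_sortedE _ ltn ltn_trans 0).
have memD i : i \in sort leq D -> 0 < i < n.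
  by rewrite mem_sort => /(fsubsetP sDn); rewrite mem_below.
apply/andP; split.
  rewrite all_rcons /= n_gt0; by apply/allP=> i /memD/andP[].
have sD : sorted ltn (sort leq D).
  by rewrite ltn_sorted_uniq_leq sort_uniq fset_uniq (sort_sorted leq_total).
case: (sort leq D) memD sD => //= a s memD sD.
rewrite rcons_path sD /=.
by have /andP[] := memD _ (mem_last a s).
Qed.

Lemma below0 (D : {fset nat}) : (D `<=` below 0)%fset -> D = fset0.
Proof.
move=> sD0; apply/eqP; rewrite -fsubset0; apply: fsubset_trans sD0 _.
by apply/fsubsetP=> i; rewrite mem_below ltn0 andbF.
Qed.

Lemma comp_of0 : comp_of 0 fset0 = [::].
Proof.
have s0 : sort leq (fset0 : {fset nat}) = [::].
  by apply: size0nil; rewrite size_sort; apply: cardfs0.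
by rewrite /comp_of s0 /= insubF.
Qed.

Lemma wsum_comp_of n D : (D `<=` below n)%fset -> wsum (comp_of n D) = n.
Proof.
case: n => [|n] sDn.
  by rewrite (below0 sDn) comp_of0.
have p := path_below sDn isT.
rewrite /wsum /comp_of diff_pos //.
have := sumn_take_diff p (leqnn _).
rewrite add0n take_oversize ?size_pairmap // => ->.
by rewrite -last_nth last_rcons.
Qed.

Lemma comp_ofK n D : (D `<=` below n)%fset -> partial_sums (comp_of n D) = D.
Proof.
case: n => [|n] sDn.
  rewrite (below0 sDn) comp_of0; apply/fsetP=> i; rewrite inE.
  by apply/negbTE/negP => /imfsetP[j].
have p := path_below sDn isT.
have szq : size (comp_of n.+1 D) = (size (sort leq D)).+1.
  by rewrite -(size_map val) diff_pos // size_pairmap size_rcons.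
have ws i : i <= size (sort leq D) ->
    wsum (take i (comp_of n.+1 D)) = nth 0 (0 :: sort leq D) i.
  move=> le_i; rewrite /wsum map_take diff_pos // -[sumn _]add0n sumn_take_diff //.
    by case: i le_i => //= i le_i; rewrite nth_rcons le_i.
  by rewrite size_rcons; apply: leqW.
apply/fsetP=> i; rewrite -[RHS](mem_sort leq); apply/imfsetP/idP => [[j /=]|].
  rewrite mem_index_iota szq ltnS => /andP[j0 jD] ->; rewrite ws //.
  by case: j j0 jD => //= j _ jD; rewrite mem_nth.
move=> iD; exists (index i (sort leq D)).+1; rewrite ?ws ?index_mem //=.
  by rewrite mem_index_iota szq !ltnS index_mem.
by rewrite nth_index.
Qed.
Lemma wsum_cat q r : wsum (q ++ r) = wsum q + wsum r.
Proof. by rewrite /wsum map_cat sumn_cat. Qed.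

Lemma wsum_gt0 q : (0 < wsum q) = (0 < size q).
Proof. by case: q => //= -[m m0] q; rewrite /wsum /= ltn_addr. Qed.

Lemma wsum_take_lt q i j : i < j <= size q -> wsum (take i q) < wsum (take j q).
Proof.
case/andP=> ltij lejq; rewrite -[in ltnRHS](subnKC (ltnW ltij)) takeD wsum_cat.
by rewrite -[ltnLHS]addn0 ltn_add2l wsum_gt0 size_take_min size_drop; lia.
Qed.

Lemma partial_sums_below q : (partial_sums q `<=` below (wsum q))%fset.
Proof.
apply/fsubsetP => i /imfsetP[j /=]; rewrite mem_index_iota => /andP[j0 jq] ->.
rewrite mem_below wsum_gt0 size_take jq j0 /= -{2}(take_size q).
by rewrite wsum_take_lt ?jq /=.
Qed.

Lemma comp_of_partial_sums q : comp_of (wsum q) (partial_sums q) = q.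
Proof.
have inj : injective (map val : word -> seq nat) by exact/inj_map/val_inj.
have srt : sort leq (partial_sums q) =
  [seq wsum (take i q) | i <- index_iota 1 (size q)].
  have ltS : sorted ltn [seq wsum (take i q) | i <- index_iota 1 (size q)].
    rewrite sorted_map; apply/(sortedP 0) => i; rewrite size_iota => lti.
    by rewrite !nth_iota; [rewrite /= wsum_take_lt|..]; lia.
  have := ltS; rewrite ltn_sorted_uniq_leq => /andP[uS leS].
  apply: (sorted_eq leq_trans anti_leq) => //; first exact: sort_sorted leq_total _.
  rewrite perm_sort; apply: uniq_perm; rewrite ?fset_uniq // => i.
  by apply/imfsetP/mapP.
have [/size0nil->|q0] := posnP (size q).
  by rewrite (below0 (partial_sums_below [::])) comp_of0.
apply: inj; rewrite /comp_of diff_pos; last first.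
  by apply: path_below; [exact: partial_sums_below | rewrite wsum_gt0].
rewrite srt -[RHS](scanlK addKn 0); congr pairmap.
have foldl_sumn s : foldl addn 0 s = sumn s.
  by elim/last_ind: s => // s x IHs; rewrite foldl_rcons sumn_rcons IHs.
apply: (@eq_from_nth _ 0) => [|i].
  by rewrite size_rcons size_map size_iota size_scanl size_map subn1 prednK.
rewrite size_rcons size_map size_iota subn1 prednK // => lti.
rewrite nth_scanl ?size_map //.
rewrite foldl_sumn -map_take -/(wsum _) nth_rcons size_map size_iota.
rewrite subn1; case: ltngtP => [lt_i|gt_i|eq_i]; [|by case: (size q) q0 lti gt_i; lia|].
  by rewrite /index_iota subn1 (nth_map 0) ?size_iota // nth_iota // add1n.
by rewrite eq_i prednK // take_size.
Qed.

Lemma mem_compositions n q : (q \in compositions n) = (wsum q == n).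
Proof.
apply/mapP/eqP => [[D]|<-]; first by rewrite fpowersetE => /wsum_comp_of ? ->.
exists (partial_sums q); last by rewrite comp_of_partial_sums.
by rewrite fpowersetE partial_sums_below.
Qed.

Lemma compositions_uniq n : uniq (compositions n).
Proof.
rewrite map_inj_in_uniq ?fset_uniq // => D E; rewrite !fpowersetE => sD sE eqDE.
by rewrite -(comp_ofK sD) eqDE comp_ofK.
Qed.

End Compositions.

(* All permutations of all sets [{1, ..., n}], [n >= 0]. *)
Definition perms : choiceType := {n : nat & 'S_n}.

Definition perm_in (n : nat) (s : 'S_n) : perms := Tagged (fun n => 'S_n) s.

(* The image of [i] in [{1, ..., n}] under [s]; ['S_n] acts on [{0, ..., n-1}]. *)
Definition letter (n : nat) (s : 'S_n) (i : nat) : nat :=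
  nth 0%N [seq (val (s j)).+1 | j <- enum 'I_n] i.-1.

Definition Des (n : nat) (s : 'S_n) : {fset nat} :=
  [fset i in index_iota 1 n | (letter s i.+1 < letter s i)%N]%fset.

Definition Peak (n : nat) (s : 'S_n) : {fset nat} :=
  [fset i in index_iota 2 n |
    (letter s i.-1 < letter s i)%N && (letter s i.+1 < letter s i)%N]%fset.

Definition is_peak_set (n : nat) (P : {fset nat}) : bool :=
  (P `<=` [fset i in index_iota 2 n])%fset && (P `&` shiftP P == fset0)%fset.

(* Pairs [(n, P)] with [P] a peak set in [{1, ..., n}]. *)
Definition peakset : choiceType :=
  {x : nat * {fset nat} | is_peak_set x.1 x.2}.

Section Algebras.

Variable K : fieldType.

(* The direct sum of the group algebras [K S_n], and its tensor square. *)
Definition KS : lmodType K := {malg K[perms]}.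
Definition KS2 : lmodType K := {malg K[(perms * perms)%type]}.

Definition tens (phi psi : KS) : KS2 :=
  \sum_(s <- msupp phi) \sum_(t <- msupp psi)
    << phi@_s * psi@_t *g (s, t) >>.

(* The products of the [K S_n], permutations of different degrees having
   product 0. The product of ['S_n] reads from left to right: [permM]. *)
Definition inner (phi psi : KS) : KS :=
  \sum_(s <- msupp phi) \sum_(t : 'S_(tag s))
    << phi@_s * psi@_(perm_in t) *g perm_in (tagged s * t)%g >>.

Definition Delta_set (n : nat) (D : {fset nat}) : KS :=
  \sum_(s : 'S_n | Des s == D) << perm_in s >>.

Definition Xi_set (n : nat) (D : {fset nat}) : KS :=
  \sum_(E <- fpowerset D) Delta_set n E.

Definition Delta (q : word) : KS := Delta_set (wsum q) (partial_sums q).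
Definition Xi (q : word) : KS := Xi_set (wsum q) (partial_sums q).

Definition Pi_set (n : nat) (P : {fset nat}) : KS :=
  \sum_(s : 'S_n | Peak s == P) << perm_in s >>.

Definition Pi (P : peakset) : KS := Pi_set (val P).1 (val P).2.

Definition descent_algebra : set KS := span (range Delta).
Definition peak_algebra : set KS := span (range Pi).

Definition star : KS -> KS -> KS :=
  extend2 Xi Xi (fun r q => Xi (r ++ q)).

Definition Xi_tilde (n : nat) : KS :=
  if n is 0 then << perm_in (1%g : 'S_0) >> else 2%:R *: Pi_set n fset0.

(* Linear on [KS], and equal to [phi |-> inner phi (Xi_tilde n)] on [K S_n]. *)
Definition iota_Xi (phi : KS) : KS :=
  lincomb phi (fun s => inner << s >> (Xi_tilde (tag s))).

Definition ker_iota : set KS :=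
  [set phi | descent_algebra phi /\ iota_Xi phi = 0].

(* Formal power series in the variables x_0, x_1, x_2, ... and in two sets of
   such variables: a series is the function giving its coefficients, and
   [ptens f g] is the series f(x) g(y). *)
Definition series : lmodType K := {cmonom nat} -> K^o.
Definition series2 : lmodType K := ({cmonom nat} * {cmonom nat})%type -> K^o.

Definition ptens (f g : series) : series2 := fun m => f m.1 * g m.2.

(* x_{i_1}^{r_1} ... x_{i_l}^{r_l} *)
Definition monomial (i : seq nat) (r : word) : {cmonom nat} :=
  \big[mmul/mone]_(p <- zip i r) expcmn (ucm p.1) (val p.2).

(* For fixed [r], distinct increasing [i] give distinct monomials, so every
   coefficient of the sum of these monomials is 0 or 1. *)
Definition M (r : word) : series := fun m =>
  (`[< exists i : seq nat,
      [/\ sorted ltn i, size i = size r & m = monomial i r] >])%:R.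

Definition F (q : word) : series :=
  \sum_(r <- compositions (wsum q) | (partial_sums q `<=` partial_sums r)%fset)
    M r.

Definition F_set (n : nat) (D : {fset nat}) : series := F (comp_of n D).

Definition Qsym : set series := span (range M).

Definition gamma : series -> series2 :=
  extend M (fun r => \sum_(i < (size r).+1) ptens (M (take i r)) (M (drop i r))).

Definition pairing : KS -> series -> K^o :=
  extend2 Delta F (fun q s => (q == s)%:R).

Definition Kpeak (P : peakset) : series :=
  let: (n, Q) := val P in
  \sum_(D <- fpowerset (below n) | (Q `<=` symdiff D (shiftS D))%fset) F_set n D.

Definition stembridge : set series := span (range Kpeak).

Definition stembridge_perp : set KS :=
  [set phi | descent_algebra phi /\
             forall f, stembridge f -> pairing phi f = 0].

Definition tensor_square (A : set series) : set series2 :=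
  span [set ptens f g | f in A & g in A].

Definition sub_coalgebra (A : set series) : Prop :=
  A `<=` Qsym /\ forall f, A f -> tensor_square A (gamma f).

(* Stembridge's normalisation of the basis of the peak algebra. *)
Definition Kpeak_norm (P : peakset) : series :=
  let: (n, Q) := val P in
  (if n is 0 then 1 else 2%:R ^+ (#|` Q|).+1) *: Kpeak P.

(* The pairing for which [Pi] and [Kpeak_norm] are dual bases. The powers of 2
   are forced: [iota_Xi (Delta_set n D)] is the sum of the [2 ^ (|P| + 1) Pi^P]
   over the peak sets [P] contained in [symdiff D (shiftS D)], [n > 0], so that
   [peak_pairing (iota_Xi phi) f = pairing phi f]. For the pairing dual to
   [Kpeak] itself, the compatibility of [star] and [gamma] fails in degree 2:
   there Pi_1 * Pi_1 = Pi_2 pairs to 1 with K_2 = M_2 + 2 M_11, but the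
   component of bidegree (1, 1) of [gamma K_2] is 2 M_1 (x) M_1, which pairs
   to 2 with Pi_1 (x) Pi_1 (all peak sets being empty). *)
Definition peak_pairing : KS -> series -> K^o :=
  extend2 Pi Kpeak_norm (fun P Q => (P == Q)%:R).

Definition peak_pairing2 : KS2 -> series2 -> K^o :=
  extend2 (fun P : peakset * peakset => tens (Pi P.1) (Pi P.2))
          (fun Q : peakset * peakset => ptens (Kpeak_norm Q.1) (Kpeak_norm Q.2))
          (fun P Q => peak_pairing (Pi P.1) (Kpeak_norm Q.1) *
                      peak_pairing (Pi P.2) (Kpeak_norm Q.2)).

End Algebras.

Arguments descent_algebra {K}.
Arguments peak_algebra {K}.
Arguments stembridge {K}.
Arguments Qsym {K}.
Arguments ker_iota {K}.
Arguments stembridge_perp {K}.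

(* Main.v *)
(* A permutation whose inverse is peakless is the sorting permutation of an
   order on the values that puts a set A first, decreasingly, and then its
   complement, increasingly; the two choices for the least value are equivalent.
   Hence 2 Pi^{} is a sum over all sets A, and the coefficient of s in
   Delta^D (2 Pi^{}) is the number of A such that s followed by that sorting
   permutation has descent set D. Each i prescribes the membership of a single
   letter of s in A: the i-th one at a descent of s, the (i+1)-st one at an
   ascent. A letter is prescribed twice exactly at the peaks of s, consistently
   if and only if the peak is in D xor (D+1), and it is
   free exactly at the valleys, of which there is one more than peaks. So
   iota maps Delta^D to the sum of the <Delta^D, Kpeak_norm P> Pi^P, which gives
   the kernel.

   Cutting at k = 0, ..., n turns F_D into a sum of F_{D < k} (x) F_{D > k}, and
   Kpeak_norm Q into a sum, without coefficients, of the tensors of Kpeak_norm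
   for the peaks of Q before k and after k + 1. Dually Pi^P * Pi^Q is the sum of
   the words whose two parts have peak sets P and Q. *)
Require Import Defs.
From HB Require Import structures.
From mathcomp Require Import all_boot all_order all_algebra all_fingroup.
From mathcomp Require Import finmap monalg zify.
From mathcomp Require Import boolp classical_sets functions.
(* [span] and [coord] must denote those of [Defs], not those of [vector]. *)
Import Defs.

Set Implicit Arguments.
Unset Strict Implicit.
Unset Printing Implicit Defensive.

Import GRing.Theory.

Local Open Scope classical_set_scope.
Local Open Scope ring_scope.

(** * Linear combinations and triangular families *)
Section Lincomb.
Variable K : fieldType.

Definition freeb (I : choiceType) (V : lmodType K) (b : I -> V) :=
  injective (fun c : {malg K[I]} => lincomb c b).

Section Theory.
Variables (I : choiceType) (V : lmodType K).
Implicit Types (b : I -> V) (c : {malg K[I]}).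

Lemma lincombEw (d : {fset I}) c b : (msupp c `<=` d)%fset ->
  lincomb c b = \sum_(i <- d) c@_i *: b i.
Proof.
move=> le_d; rewrite /lincomb (big_fset_incl _ le_d) //= => i _.
by move/mcoeff_outdom->; rewrite scale0r.
Qed.

(** The arguments of [lincomb] are exchanged so that, for a fixed family, a linear structure can be
    put on the function of the coefficients. *)
Definition lincombr b c : V := lincomb c b.

Lemma lincombr_is_linear b : linear (lincombr b).
Proof.
move=> a c d; rewrite /lincombr.
pose m := (msupp c `|` msupp d `|` msupp (a *: c + d))%fset.
rewrite !(@lincombEw m); first last.
- exact: fsubsetUr.
- by rewrite /m -fsetUA fsubsetUl.
- by rewrite /m [X in (X `|` _)%fset]fsetUC -fsetUA fsubsetUl.
rewrite scaler_sumr -big_split; apply: eq_bigr => i _ /=.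
by rewrite mcoeffD mcoeffZ scalerDl scalerA.
Qed.

HB.instance Definition _ b :=
  GRing.isLinear.Build K {malg K[I]} V _ (lincombr b) (lincombr_is_linear b).

Lemma lincombD b c d : lincomb (c + d) b = lincomb c b + lincomb d b.
Proof. exact: (raddfD (lincombr b)). Qed.

Lemma lincomb0 b : lincomb 0 b = 0.
Proof. exact: (raddf0 (lincombr b)). Qed.

Lemma lincombZ b a c : lincomb (a *: c) b = a *: lincomb c b.
Proof. exact: (linearZ_LR (lincombr b)). Qed.

Lemma lincomb_sum b J (r : seq J) (p : pred J) (c : J -> {malg K[I]}) :
  lincomb (\sum_(j <- r | p j) c j) b = \sum_(j <- r | p j) lincomb (c j) b.
Proof. exact: (raddf_sum (lincombr b)). Qed.

Lemma lincombU b i : lincomb << i >> b = b i.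
Proof.
by rewrite (lincombEw (d := [fset i]%fset)) ?msuppU_le // big_seq_fset1 mcoeffUU
  scale1r.
Qed.

Lemma eq_lincomb b b' c : b =1 b' -> lincomb c b = lincomb c b'.
Proof. by move=> eq_b; apply: eq_bigr => i _; rewrite eq_b. Qed.

Lemma lincomb_gZ b a c : lincomb c (fun i => a *: b i) = a *: lincomb c b.
Proof.
by rewrite /lincomb scaler_sumr; apply: eq_bigr => i _; rewrite !scalerA mulrC.
Qed.

Lemma lincomb_g0 c : lincomb c (fun=> 0 : V) = 0.
Proof. by rewrite /lincomb big1 // => i _; rewrite scaler0. Qed.

Lemma linear_lincomb (W : lmodType K) (f : V -> W) b c :
  linear f -> f (lincomb c b) = lincomb c (f \o b).
Proof.
move=> lin_f; have f0 : f 0 = 0.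
  by have := lin_f (-1) 0 0; rewrite scaler0 addr0 scaleN1r addNr.
rewrite /lincomb; elim: (enum_fset (msupp c)) => [|i s IHs].
  by rewrite !big_nil.
by rewrite !big_cons lin_f IHs.
Qed.

Lemma lincombN b c : lincomb (- c) b = - lincomb c b.
Proof. exact: (raddfN (lincombr b)). Qed.

Lemma freeb_ker b : (forall c, lincomb c b = 0 -> c = 0) -> freeb b.
Proof.
move=> b0 c d /= eq_cd; apply/eqP; rewrite -subr_eq0; apply/eqP/b0.
by rewrite lincombD lincombN eq_cd subrr.
Qed.

(** In a vanishing combination choose an index of least rank in the support: its functional kills
    every other term, so its own coefficient is 0. *)
Lemma freeb_triangular b (phi : I -> V -> K) (rk : I -> nat) :
  (forall i, scalar (phi i)) -> (forall i, phi i (b i) != 0) ->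
  (forall i j, i != j -> (rk i <= rk j)%N -> phi i (b j) = 0) -> freeb b.
Proof.
move=> lin_phi phi_ne0 phi_eq0; apply: freeb_ker => c c0.
have [//|c_ne0] := eqVneq c 0.
have /fset0Pn[i0 ci0] : msupp c != fset0.
  apply: contraNneq c_ne0 => c0'; apply/eqP/malgP => k.
  by rewrite mcoeff0 mcoeff_outdom // c0' inE.
have ex_k : exists n, has (fun i => rk i == n) (msupp c).
  by exists (rk i0); apply/hasP; exists i0.
case: (ex_minnP ex_k) => n /hasP[i ci /eqP <-] min_i.
have := @linear_lincomb K^o (phi i) b c (lin_phi i); rewrite c0.
have -> : phi i 0 = 0.
  by have := lin_phi i (-1) 0 0; rewrite scaler0 addr0 mulN1r addNr.
rewrite /lincomb (big_fsetD1 i) //= big1_seq => [|j].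
  move/esym/eqP; rewrite addr0 /GRing.scale /= mulf_eq0 (negbTE (phi_ne0 i)) orbF.
  by rewrite mcoeff_eq0 ci.
rewrite !inE /= => /andP[ne_ji cj]; rewrite phi_eq0 ?scaler0 1?eq_sym //.
by apply: min_i; apply/hasP; exists j.
Qed.

End Theory.

Section Extend.
Variables (I : choiceType) (V : lmodType K).
Implicit Types (b : I -> V) (c : {malg K[I]}).

Lemma coord_basis b i : freeb b -> coord b (b i) = << i >>.
Proof. by move=> b_free; rewrite -[in LHS](lincombU b) coordK. Qed.

Lemma extend_lincomb (W : lmodType K) b (g : I -> W) c :
  freeb b -> extend b g (lincomb c b) = lincomb c g.
Proof. by move=> b_free; rewrite /extend coordK. Qed.

Lemma extend_basis (W : lmodType K) b (g : I -> W) i :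
  freeb b -> extend b g (b i) = g i.
Proof. by move=> b_free; rewrite /extend coord_basis // lincombU. Qed.

Lemma span_rangeP b v : span (range b) v <-> exists c, v = lincomb c b.
Proof.
split=> [[s [s_b ->]]|[c ->]]; last first.
  exists [seq (c@_i, b i) | i <- msupp c]; rewrite big_map; split=> // x.
  by case/mapP=> i _ ->; exists i.
elim: s s_b => [|[a w] s IHs] s_b.
  by exists 0; rewrite big_nil lincomb0.
have [|c eq_c] := IHs; first by move=> x xs; apply: s_b; rewrite inE xs orbT.
have [/= i _ eq_w] := s_b (a, w) (mem_head _ _).
by exists (a *: << i >> + c); rewrite big_cons lincombD lincombZ lincombU eq_w eq_c.
Qed.

Lemma span_lincomb b c : span (range b) (lincomb c b).
Proof. by apply/span_rangeP; exists c. Qed.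

End Extend.

Lemma lincomb_lincomb (I J : choiceType) (V : lmodType K) (b : I -> V)
    (a : J -> {malg K[I]}) c :
  lincomb (lincomb c a) b = lincomb c (fun j => lincomb (a j) b).
Proof. exact: (linear_lincomb _ _ (lincombr_is_linear b)). Qed.

Lemma freeb_comp (I J : choiceType) (V : lmodType K) (b : I -> V)
    (a : J -> {malg K[I]}) :
  freeb b -> freeb a -> freeb (fun j => lincomb (a j) b).
Proof. by move=> b_free a_free c d /=; rewrite -!lincomb_lincomb => /b_free/a_free. Qed.

Lemma lincomb_exchange (I J : choiceType) (V : lmodType K) (g : I -> J -> V) x y :
  lincomb x (fun i => lincomb y (g i)) = lincomb y (fun j => lincomb x (g ^~ j)).
Proof.
rewrite /lincomb; under eq_bigr => i _ do rewrite scaler_sumr.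
rewrite exchange_big; apply: eq_bigr => j _; rewrite scaler_sumr.
by apply: eq_bigr => i _; rewrite !scalerA mulrC.
Qed.

Lemma mcoeff_lincomb (I J : choiceType) (b : I -> {malg K[J]}) c j :
  (lincomb c b)@_j = lincomb c (fun i => (b i)@_j : K^o).
Proof.
apply: (@linear_lincomb I {malg K[J]} K^o (mcoeff j)) => a x y.
by rewrite mcoeffD mcoeffZ.
Qed.

Lemma lincomb_delta (I : choiceType) (c : {malg K[I]}) j :
  lincomb c (fun i => (j == i)%:R : K^o) = c@_j.
Proof.
rewrite [in RHS](monalgE c) raddf_sum; apply: eq_bigr => i _ /=.
by rewrite mcoeffU eq_sym; exact: mulr_natr.
Qed.

Section Extend2.
Variables (I J : choiceType) (V W U : lmodType K) (b : I -> V) (c : J -> W).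
Variable g : I -> J -> U.
Hypotheses (b_free : freeb b) (c_free : freeb c).

Lemma extend2_lincomb x y :
  extend2 b c g (lincomb x b) (lincomb y c)
    = lincomb x (fun i => lincomb y (g i)).
Proof.
by rewrite /extend2 extend_lincomb //; apply: eq_lincomb => i; exact: extend_lincomb.
Qed.

Lemma extend2_basis i j : extend2 b c g (b i) (c j) = g i j.
Proof. by rewrite /extend2 !extend_basis. Qed.

End Extend2.

End Lincomb.

(** * Descents, peaks and permutations with peakless inverse *)
Section Permutations.
Local Open Scope nat_scope.

Lemma notin_below n (D : {fset nat}) i :
  i \notin below n -> (D `<=` below n)%fset -> i \in D = false.
Proof. by move=> /negbTE ni /fsubsetP sD; apply/negP=> /sD; rewrite ni. Qed.

Lemma letterE n (s : 'S_n) (i : 'I_n) : letter s i.+1 = (s i).+1.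
Proof. by rewrite /letter (nth_map i) ?size_enum_ord //= nth_ord_enum. Qed.

Lemma perm_leq n (s : 'S_n) (x y : 'I_n) :
  x != y :> nat -> (s x <= s y) = (s x < s y).
Proof.
by move=> ne; rewrite leq_eqVlt (inj_eq val_inj) (inj_eq perm_inj) -(inj_eq val_inj)
  (negbTE ne).
Qed.

Lemma mem_Des n (s : 'S_n) (x y : 'I_n) :
  y = x.+1 :> nat -> ((y : nat) \in Des s) = (s y < s x).
Proof.
move=> eq_y; rewrite /Des !inE /= mem_index_iota ltn_ord andbT letterE eq_y.
by rewrite letterE ltnS.
Qed.

Lemma Des_below n (s : 'S_n) : (Des s `<=` below n)%fset.
Proof.
by apply/fsubsetP=> i; rewrite mem_below !inE /= mem_index_iota => /andP[].
Qed.

(** Starts of the maximal runs of descents; a run starting at position 1 is excluded, for want of a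
    left neighbour. *)
Definition peaks_of (D : {fset nat}) : {fset nat} :=
  [fset i in D | (1 < i) && (i.-1 \notin D)]%fset.

Lemma mem_peaks_of D i :
  (i \in peaks_of D) = [&& i \in D, 1 < i & i.-1 \notin D].
Proof. by rewrite !inE. Qed.

Lemma Peak_Des n (s : 'S_n) : Peak s = peaks_of (Des s).
Proof.
apply/fsetP=> i; rewrite mem_peaks_of /Peak /Des !inE /= !mem_index_iota.
case: i => [|[|i]] /=; rewrite ?andbF //.
have [lt_in|] := boolP (i.+2 < n); rewrite ?andbF //=.
have i1n : i.+1 < n by lia.
have i0n : i < n by lia.
rewrite -[i.+2]/((Ordinal i1n).+1) -[i.+1]/((Ordinal i0n).+1) !letterE /=.
by rewrite i1n andbC /= ltnS [in RHS]ltnS -leqNgt perm_leq //= neq_ltn ltnSn.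
Qed.

Lemma is_peak_setP n (P : {fset nat}) :
  reflect ((forall i, i \in P -> 1 < i < n) /\ (forall i, i \in P -> i.+1 \notin P))
    (is_peak_set n P).
Proof.
apply: (iffP andP) => [[/fsubsetP sP /eqP P0]|[sP P0]]; split.
- by move=> i /sP; rewrite in_fset /= mem_index_iota.
- move=> i iP; apply: contraT; rewrite negbK => i1P; rewrite -(in_fset0 i) -P0.
  by rewrite inE iP; apply/imfsetP; exists i.+1.
- by apply/fsubsetP=> i /sP; rewrite in_fset /= mem_index_iota.
- apply/eqP/fsetP=> i; rewrite !inE; apply/negP => /andP[iP /imfsetP[j /= jP ij]].
  have := sP j jP; have := P0 i iP; rewrite ij prednK ?jP //.
  by have := sP j jP; lia.
Qed.

Lemma peaks_of_peak_set n D : (D `<=` below n)%fset -> is_peak_set n (peaks_of D).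
Proof.
move=> /fsubsetP sD; apply/is_peak_setP; split=> i; rewrite !mem_peaks_of.
  by case/and3P=> /sD; rewrite mem_below => /andP[_ ->] ->.
by case/and3P=> -> i1 _; rewrite !andbF.
Qed.

Lemma is_peak_set_below n P : is_peak_set n P -> (P `<=` below n)%fset.
Proof.
by case/is_peak_setP=> sP _; apply/fsubsetP=> i /sP; rewrite mem_below; lia.
Qed.

(** No two peaks are adjacent, so each starts its own run. Hence a word with descent set [P] also
    has peak set [P], and every peak set occurs. *)
Lemma peaks_ofK n P : is_peak_set n P -> peaks_of P = P.
Proof.
case/is_peak_setP=> sP P0; apply/fsetP=> i; rewrite mem_peaks_of.
have [iP|//] := boolP (i \in P); have /andP[i1 _] := sP i iP; rewrite i1 /=.
apply/negP=> /P0; rewrite prednK ?iP //; lia.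
Qed.

Lemma card_ord_ltn n (k : 'I_n) : #|[set z : 'I_n | z < k]%SET| = k.
Proof.
have -> : [set z : 'I_n | z < k]%SET
    = [set widen_ord (ltnW (ltn_ord k)) x | x : 'I_k]%SET.
  apply/setP=> z; rewrite inE; apply/idP/imsetP => [lt_zk|[y _ ->]] //=.
  by exists (Ordinal lt_zk); rewrite ?inE //; apply: ord_inj.
by rewrite card_imset ?cardsT ?card_ord // => x y [eq_xy]; apply: ord_inj.
Qed.

(** [s] maps this set onto the initial segment below [s x]. So comparisons determine a permutation,
    which [eq_perm_order] uses. *)
Lemma perm_rankE n (s : 'S_n) x : s x = #|[set z | s z < s x]%SET| :> nat.
Proof.
rewrite -[LHS]card_ord_ltn -(card_imset _ (@perm_inj _ s)); congr #|pred_of_set _|.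
apply/setP=> z; rewrite inE; apply/idP/imsetP => [lt_z|[y]].
  by exists (s^-1 z)%g; rewrite ?inE permKV.
by rewrite inE => lt_y ->.
Qed.

Lemma eq_perm_order n (s t : 'S_n) :
  (forall x y : 'I_n, x < y -> (s y < s x) = (t y < t x)) -> s = t.
Proof.
move=> eq_st; have {}eq_st x y : (s y < s x) = (t y < t x).
  case: (ltngtP x y) => [/eq_st // | lt_yx | /val_inj->]; last by rewrite !ltnn.
  have neP (u : 'S_n) : (u y < u x) = ~~ (u x < u y).
    by rewrite -leqNgt perm_leq // neq_ltn lt_yx.
  by rewrite neP eq_st // -neP.
apply/permP => x; apply: val_inj; rewrite /= (perm_rankE s x) (perm_rankE t x).
by congr #|pred_of_set _|; apply/setP => z; rewrite !inE.
Qed.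

Section OrderOfKey.
Variables (n : nat) (key : 'I_n -> nat).
Hypothesis key_inj : injective key.

Lemma key_rank_subproof x : #|[set z | key z < key x]%SET| < n.
Proof.
rewrite -[n in _ < n]card_ord -cardsT; apply: proper_card; apply/properP.
by split; [exact: finset.subsetT | exists x; rewrite ?inE ?ltnn].
Qed.

Definition key_rank x := Ordinal (key_rank_subproof x).

Lemma key_rank_mono x y : (key_rank x < key_rank y) = (key x < key y).
Proof.
have lt_rank u v : key u < key v -> key_rank u < key_rank v.
  move=> lt_uv; apply: proper_card; apply/properP; split.
    by apply/fintype.subsetP=> z; rewrite !inE => /ltn_trans->.
  by exists u; rewrite !inE ?ltnn.
apply/idP/idP; last exact: lt_rank.
apply: contraTT; rewrite -!leqNgt leq_eqVlt => /orP[/eqP/key_inj->//|].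
by move/lt_rank/ltnW.
Qed.

Lemma key_rank_inj : injective key_rank.
Proof.
move=> x y eq_xy; apply: key_inj.
by case: (ltngtP (key x) (key y)) => //; rewrite -key_rank_mono eq_xy ltnn.
Qed.

(** The standardisation of the word of keys. *)
Definition key_perm : 'S_n := perm key_rank_inj.

Lemma key_permE x y : (key_perm x < key_perm y) = (key x < key y).
Proof. by rewrite !permE key_rank_mono. Qed.

End OrderOfKey.

(* The key ordering the elements of [A] first, decreasingly, and then the other
   elements increasingly. *)
Definition vkey n (A : {ffun 'I_n -> bool}) (x : 'I_n) : nat :=
  if A x then n.-1 - x else n + x.

Lemma vkey_inj n (A : {ffun 'I_n -> bool}) : injective (vkey A).
Proof.
move=> x y; have := ltn_ord x; have := ltn_ord y; rewrite /vkey => ltx lty eq_k.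
by apply: val_inj => /=; move: eq_k; case: (A x); case: (A y); lia.
Qed.

Definition vperm n (A : {ffun 'I_n -> bool}) : 'S_n := key_perm (@vkey_inj n A).

(** The larger element decides: inside [A] it is placed before all smaller elements, outside [A]
    after all of them. *)
Lemma vpermE n (A : {ffun 'I_n -> bool}) (x y : 'I_n) :
  x < y -> (vperm A y < vperm A x) = A y.
Proof.
move=> lt_xy; rewrite key_permE /vkey; have := ltn_ord y.
by case: (A x); case: (A y); lia.
Qed.

(** By [vpermE], [vperm A] descends between neighbouring positions exactly when the second one is in
    [A], so [A] can be copied from [D]. *)
Lemma Des_realizable n (D : {fset nat}) : (D `<=` below n)%fset ->
  exists s : 'S_n, Des s = D.
Proof.
move=> sD; exists (vperm [ffun x : 'I_n => (x : nat) \in D]).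
apply/fsetP=> i; have [|ni] := boolP (i \in below n); last first.
  by rewrite !(notin_below ni) // Des_below.
rewrite mem_below.
case: i => // i lt_in; have lt_i : i < n by lia.
by rewrite (@mem_Des _ _ (Ordinal lt_i) (Ordinal lt_in)) // vpermE // ffunE.
Qed.

(* Between a smaller value on its left and one on its right, the maximum of a
   word is a peak. *)
Lemma Peak0_unimodal n (t : 'S_n) (p q r : 'I_n) : Peak t = fset0 ->
  p < q < r -> ~~ ((t p < t q) && (t r < t q)).
Proof.
move=> t0 /andP[ltpq ltqr]; apply/negP=> /andP[tpq trq].
have q_in : p <= q <= r by rewrite (ltnW ltpq) (ltnW ltqr).
case: (@arg_maxnP _ q (fun m : 'I_n => p <= m <= r) (fun m => t m) q_in) => m.
move=> /andP[lepm lemr] max_m; have le_qm := max_m q q_in.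
have ltpm : p < m.
  by rewrite ltn_neqAle lepm andbT; apply: contraTneq le_qm => /val_inj <-; lia.
have ltmr : m < r.
  by rewrite ltn_neqAle lemr andbT; apply: contraTneq le_qm => /val_inj ->; lia.
have ltm' : m.-1 < n by have := ltn_ord m; lia.
have ltm1 : m.+1 < n by have := ltn_ord r; lia.
(* [Peak] counts positions from 1, so the 0-based position [m] of the maximum appears as [m.+1]. *)
suff : m.+1 \in Peak t by rewrite t0 inE.
have neq (x : 'I_n) : x != m :> nat -> p <= x <= r -> t x < t m.
  by move=> ne_xm /max_m; rewrite -perm_leq.
rewrite Peak_Des mem_peaks_of (@mem_Des _ _ m (Ordinal ltm1)) //=.
rewrite (@mem_Des _ _ (Ordinal ltm') m) /= ?prednK; [|lia..].
rewrite neq /=; [|lia..].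
by rewrite -leqNgt (ltnW (neq _ _ _)) /=; lia.
Qed.

(** At a peak of the inverse the middle letter exceeds both neighbours, so its membership in [A]
    would place it on the same side of both, whereas one neighbour stands to its left and the other
    to its right. *)
Lemma Peak_vpermV n (A : {ffun 'I_n -> bool}) : Peak (vperm A)^-1%g = fset0.
Proof.
set t := (_^-1)%g; apply/fsetP=> i; rewrite inE Peak_Des mem_peaks_of.
apply/negP=> /and3P[iD i1 iD']; have := fsubsetP (Des_below _) _ iD.
rewrite mem_below => /andP[_ lt_in].
have lt_i1 : i.-1 < n by lia.
have lt_i2 : i.-2 < n by lia.
pose p := Ordinal lt_i2; pose q := Ordinal lt_i1; pose r := Ordinal lt_in.
have eq_q : q = p.+1 :> nat by rewrite /=; lia.
have eq_r : r = q.+1 :> nat by rewrite /=; lia.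
move: iD iD'; rewrite (mem_Des t eq_r) (mem_Des t eq_q) => lt_rq.
rewrite -leqNgt perm_leq => [lt_pq|]; last by rewrite /=; lia.
have := vpermE A lt_rq; have := vpermE A lt_pq; rewrite !permKV.
by rewrite /= => <-; lia.
Qed.

(** Membership in [A] of each positive letter is forced by its position relative to the letter 0,
    and that of 0 is free, which gives the 2. Unimodality of the inverse shows that the sets so
    obtained do yield [s]. *)
Lemma card_vperm n (s : 'S_n.+1) :
  #|[set A | vperm A == s]%SET| = if Peak s^-1%g == fset0 then 2 else 0.
Proof.
case: eqP => [s0|s_ne0]; last first.
  apply: eq_card0 => A; rewrite inE; apply/negbTE/eqP => eq_s.
  by case: s_ne0; rewrite -eq_s Peak_vpermV.
pose B b := [ffun x : 'I_n.+1 => if x == ord0 then b else s x < s ord0].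
have -> : [set A | vperm A == s]%SET = [set B true; B false]%SET.
  apply/setP=> A; rewrite !inE; apply/eqP/orP => [eq_s|].
    have eq_A : A = B (A ord0).
      apply/ffunP=> x; rewrite ffunE; case: eqP => [-> //|/eqP x0].
      by rewrite -eq_s vpermE // lt0n.
    by rewrite eq_A; case: (A ord0); [left|right].
  have vB b : vperm (B b) = s.
    apply: eq_perm_order => x y ltxy; rewrite vpermE // ffunE ifN; last first.
      by rewrite -(inj_eq val_inj) /=; lia.
    have [->//|/eqP x0] := x =P ord0.
    have lt0x : (ord0 : 'I_n.+1) < x by rewrite lt0n.
    (* In both directions a failure would place [y] between the smaller letters [x] and 0, against
       [Peak0_unimodal]. *)
    apply/idP/idP; apply: contraTT; rewrite -!leqNgt perm_leq /=; try lia.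
      move=> lt_xy; rewrite leqNgt; apply/negP=> lt_y0.
      have := Peak0_unimodal s0 (p := s x) (q := s y) (r := s ord0).
      by rewrite !permK lt_y0 lt_xy ltxy /=; lia.
    move=> lt_0y; rewrite leqNgt; apply/negP=> lt_yx.
    have := Peak0_unimodal s0 (p := s ord0) (q := s y) (r := s x).
    by rewrite !permK lt_yx lt_0y ltxy /=; lia.
  by case=> /eqP->.
rewrite cards2 (_ : B true != B false) //.
by apply/eqP=> /ffunP/(_ ord0); rewrite !ffunE eqxx.
Qed.

End Permutations.

(** * Counting the sets that produce a given descent set *)

Section Counting.
Local Open Scope nat_scope.

Definition xor_shift (D : {fset nat}) := symdiff D (shiftS D).

Lemma mem_xor_shift D i :
  (i \in xor_shift D) = ((i \in D) != (0 < i) && (i.-1 \in D)).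
Proof.
have -> : (0 < i) && (i.-1 \in D) = (i \in shiftS D).
  apply/andP/imfsetP => [[i0 iD]|[j /= jD ->]]; last by rewrite /= jD.
  by exists i.-1; rewrite ?prednK.
by rewrite !inE; case: (i \in D); case: (i \in shiftS D).
Qed.

Lemma card_fset_below n (P : {fset nat}) : (P `<=` below n)%fset ->
  \sum_(i < n) (i.+1 \in P) = #|` P|.
Proof.
move=> /fsubsetP sP; rewrite -(big_mkord xpredT (fun i => (i.+1 \in P) : nat)).
rewrite -(big_add1 _ _ 0 n.+1 xpredT (fun i => (i \in P) : nat)).
rewrite (eq_bigr (fun i => if i \in P then 1 else 0)); last first.
  by move=> i _; case: (i \in P).
rewrite -big_mkcond sum1_count -size_filter; apply/perm_size/uniq_perm.
- by rewrite filter_uniq ?iota_uniq.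
- exact: fset_uniq.
- move=> i; rewrite mem_filter mem_index_iota andb_idr // => /sP.
  by rewrite mem_below; lia.
Qed.

Section Fiber.
Variables (n : nat) (s : 'S_n) (D : {fset nat}).
Hypotheses (n_gt0 : 0 < n) (sDn : (D `<=` below n)%fset).

(** By [vpermE] the larger of two neighbouring letters of [s] decides: the first one at a descent,
    the second one at an ascent. *)
Lemma Des_mul_vperm (A : {ffun 'I_n -> bool}) (x y : 'I_n) : y = x.+1 :> nat ->
  ((y : nat) \in Des (s * vperm A)%g)
    = if (y : nat) \in Des s then ~~ A (s x) else A (s y).
Proof.
move=> eq_y; rewrite !(mem_Des _ eq_y) !permM.
have [lt_s|] := ltnP (s y) (s x); last first.
  by rewrite perm_leq => [/vpermE->|] //; lia.
rewrite -(vpermE A lt_s) -leqNgt perm_leq //.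
by apply: contraTneq lt_s => ->; rewrite ltnn.
Qed.

(* The value of [A] at [s x] is prescribed by the position [x.+1] of [D] if
   [s] descends there, and by the position [x] if [s] ascends there. *)
Let ok (x : nat) (b : bool) :=
  ((x.+1 \in Des s) ==> (b == (x.+1 \notin D)))
    && ((0 < x) && (x \notin Des s) ==> (b == (x \in D))).

(** Each position constrains a single letter. Regrouped by letter, the constraints are independent,
    so the sets [A] form a product. *)
Lemma Des_mul_vperm_eq (A : {ffun 'I_n -> bool}) :
  (Des (s * vperm A)%g == D) = [forall x : 'I_n, ok x (A (s x))].
Proof.
apply/eqP/forallP => [eq_D x|ok_A].
  apply/andP; split; apply/implyP; [move=> x1s | case/andP=> x0 xs].
    have lt_x1 : x.+1 < n.
      by have := fsubsetP (Des_below s) _ x1s; rewrite mem_below.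
    have := @Des_mul_vperm A x (Ordinal lt_x1) erefl.
    by rewrite /= x1s eq_D => ->; rewrite negbK.
  have lt_x : x.-1 < n by have := ltn_ord x; lia.
  have := @Des_mul_vperm A (Ordinal lt_x) x; rewrite /= prednK // => /(_ erefl).
  by rewrite (negbTE xs) eq_D => ->.
apply/fsetP=> i; have [|ni] := boolP (i \in below n); last first.
  by rewrite !(notin_below ni) // Des_below.
rewrite mem_below; case: i => // i lt_in; have lt_i : i < n by lia.
rewrite (@Des_mul_vperm A (Ordinal lt_i) (Ordinal lt_in)) //=.
case: ifP => is_; first by have /andP[/implyP/(_ is_)/eqP-> _] := ok_A (Ordinal lt_i);
  rewrite negbK.
by have /andP[_ /implyP/(_ (negbT is_))/eqP->] := ok_A (Ordinal lt_in).
Qed.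

(** The descents of [s] framed by infinite letters: a descent before the first letter, none after
    the last. *)
Let e i := (i == 0) || (i \in Des s).

(** In this frame the word first descends and finally ascends, so valleys and peaks alternate, with
    a valley at both ends. *)
Lemma valleys_peaks :
  \sum_(i < n) (e i && ~~ e i.+1 : nat) = #|` Peak s|.+1.
Proof.
have peakE i : (i.+1 \in Peak s) = ~~ e i && e i.+1.
  by rewrite Peak_Des mem_peaks_of /e /= negb_or -lt0n ltnS andbC.
rewrite -(@card_fset_below n); last first.
  by rewrite Peak_Des; apply/is_peak_set_below/peaks_of_peak_set/Des_below.
have en : e n = false.
  rewrite /e; apply/negP => /orP[/eqP n0|]; first by move: n_gt0; rewrite n0.
  by move/(fsubsetP (Des_below s)); rewrite mem_below ltnn andbF.
under [in RHS]eq_bigr => i _ do rewrite peakE.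
(* The term [e m] accounts for a final descent of the prefix, whose valley is still to come. *)
suff step m : \sum_(i < m) (e i && ~~ e i.+1 : nat) + e m
    = (\sum_(i < m) (~~ e i && e i.+1 : nat)).+1 by have := step n; rewrite en addn0.
elim: m => [|m IHm]; first by rewrite !big_ord0.
rewrite !big_ord_recr /= -addSn -IHm.
by case: (e m); case: (e m.+1); rewrite /= ?addn0 ?addn1 ?addnS.
Qed.

(** The number of choices is a product over the letters: 2 at a valley, 0 at a peak with
    contradictory prescriptions, 1 elsewhere. *)
Lemma card_Des_mul_vperm :
  #|[set A | Des (s * vperm A)%g == D]%SET|
    = if (Peak s `<=` xor_shift D)%fset then 2 ^ (#|` Peak s|).+1 else 0.
Proof.
pose F (y : 'I_n) := [pred b | ok (s^-1%g y) b].
have -> : #|[set A | Des (s * vperm A)%g == D]%SET| = #|family F|.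
  apply: eq_card => A; rewrite inE Des_mul_vperm_eq; apply/forallP/familyP => okA x.
    by rewrite inE; have := okA (s^-1%g x); rewrite permKV.
  by have := okA (s x); rewrite inE permK.
rewrite card_family foldrE big_image /= (reindex_inj (@perm_inj _ s)) /=.
pose g i := (e i && ~~ e i.+1 : nat).
have okE (x : 'I_n) : #|F (s x)|
    = 2 ^ g x * ((x.+1 \in Peak s) ==> (x.+1 \in xor_shift D)).
  have -> : #|F (s x)| = ok x true + ok x false.
    by rewrite -sum1_card big_mkcond big_bool /= !inE permK; do 2!case: (ok _ _).
  rewrite mem_xor_shift Peak_Des mem_peaks_of /g /e /ok /= ltnS lt0n.
  have x0 : x == 0 :> nat -> (x : nat) \notin D.
    move=> /eqP x0; apply/negP=> /(fsubsetP sDn); rewrite mem_below x0.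
    by rewrite ltnn.
  case: eqP x0 => [_ /(_ isT)/negbTE->|_ _] /=; first by do 2!case: (_ \in _).
  by do 4!case: (_ \in _).
rewrite (eq_bigr _ (fun x _ => okE x)) big_split /= -expn_sum valleys_peaks.
case: ifP => [/fsubsetP sP|/negbT/fsubsetPn[i iP iD]].
  by rewrite big1 ?muln1 // => x _; case: implyP => // -[]; apply: sP.
have : (i \in below n).
  apply: (fsubsetP (is_peak_set_below (peaks_of_peak_set (Des_below s)))).
  by rewrite -Peak_Des.
rewrite mem_below; case: i iP iD => // i iP iD /= lt_in.
have lt_i : i < n by lia.
by rewrite (bigD1 (Ordinal lt_i)) //= iP (negbTE iD) mul0n muln0.
Qed.

End Fiber.
End Counting.

(** * Cutting words and subsets *)
Section Cutting.
Local Open Scope nat_scope.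

(** [lft] and [rgt] give the descent sets of the first [k] letters and of the remaining ones; a
    descent at [k] itself is lost in both. *)
Definition lft (k : nat) (D : {fset nat}) : {fset nat} := [fset i in D | i < k]%fset.
Definition rgt (k : nat) (D : {fset nat}) : {fset nat} :=
  [fset i - k | i in D & k < i]%fset.
(* A peak at [k + 1] does not survive the deletion of the first [k] letters. *)
Definition rgt_peaks (k : nat) (P : {fset nat}) : {fset nat} :=
  [fset i - k | i in P & k.+1 < i]%fset.

Lemma mem_lft k D i : (i \in lft k D) = (i \in D) && (i < k).
Proof. by rewrite !inE. Qed.

Lemma mem_rgt k D i : (i \in rgt k D) = (0 < i) && (i + k \in D).
Proof.
apply/imfsetP/andP => /= [[j]|[i0 iD]]; last first.
  by exists (i + k); rewrite ?inE ?iD ?addnK //; lia.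
by rewrite inE => /andP[jD ltkj] ->; rewrite subn_gt0 subnK ?(ltnW ltkj).
Qed.

Lemma mem_rgt_peaks k P i : (i \in rgt_peaks k P) = (1 < i) && (i + k \in P).
Proof.
apply/imfsetP/andP => /= [[j]|[i0 iD]]; last first.
  by exists (i + k); rewrite ?inE ?iD ?addnK //; lia.
by rewrite inE => /andP[jD ltkj] ->; rewrite subnK ?jD //; lia.
Qed.

Lemma peaks_of_lft k D : peaks_of (lft k D) = lft k (peaks_of D).
Proof.
apply/fsetP=> i; rewrite !(mem_peaks_of, mem_lft); have [lt_ik|] := ltnP i k.
  by rewrite !andbT; have -> : i.-1 < k; [lia|rewrite andbT].
by rewrite !andbF.
Qed.

(** Position [k + 1] becomes position 1, where [peaks_of] admits no peak; further right a position
    keeps its left neighbour. *)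
Lemma peaks_of_rgt k D : peaks_of (rgt k D) = rgt_peaks k (peaks_of D).
Proof.
apply/fsetP=> i; rewrite mem_peaks_of mem_rgt_peaks mem_peaks_of !mem_rgt.
case: i => [|[|i]]; rewrite /= ?andbF //=.
Qed.

Lemma lft_below n k D : (D `<=` below n)%fset -> (lft k D `<=` below k)%fset.
Proof.
move=> /fsubsetP sD; apply/fsubsetP=> i; rewrite mem_lft mem_below.
by case/andP=> /sD; rewrite mem_below => /andP[->].
Qed.

Lemma rgt_below n k D : (D `<=` below n)%fset -> (rgt k D `<=` below (n - k))%fset.
Proof.
move=> /fsubsetP sD; apply/fsubsetP=> i; rewrite mem_rgt mem_below.
by case/andP=> -> /sD; rewrite mem_below; lia.
Qed.

Lemma lft_peak_set n k P : is_peak_set n P -> is_peak_set k (lft k P).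
Proof.
case/is_peak_setP=> sP P0; apply/is_peak_setP; split=> i; rewrite !mem_lft.
  by case/andP=> /sP/andP[-> _] ->.
by case/andP=> /P0/negbTE->.
Qed.

Lemma rgt_peak_set n k P : is_peak_set n P -> is_peak_set (n - k) (rgt_peaks k P).
Proof.
case/is_peak_setP=> sP P0; apply/is_peak_setP; split=> i; rewrite !mem_rgt_peaks.
  by case/andP=> -> /sP; lia.
by case/andP=> _ /P0/negbTE; rewrite addSn => ->; rewrite andbF.
Qed.

Lemma partial_sumsP (q : word) i :
  reflect (exists2 j, 0 < j < size q & i = wsum (take j q)) (i \in partial_sums q).
Proof.
apply: (iffP (imfsetP _ _ _ _)) => [[j /= jq ->]|[j jq ->]]; exists j => //.
  by rewrite -mem_index_iota.
by rewrite /= mem_index_iota.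
Qed.

Lemma wsum_take_le (q : word) j : wsum (take j q) <= wsum q.
Proof. by rewrite -{2}(cat_take_drop j q) wsum_cat leq_addr. Qed.

Lemma lft_partial_sums (u v : word) :
  lft (wsum u) (partial_sums (u ++ v)) = partial_sums u.
Proof.
apply/fsetP=> i; rewrite mem_lft; apply/andP/partial_sumsP => [[]|[j ju ->]].
  case/partial_sumsP=> j jq ->; rewrite take_cat; case: ifP => [ju _|_].
    by exists j => //; lia.
  by rewrite wsum_cat ltnNge leq_addr.
split; last by rewrite -{2}(take_size u) wsum_take_lt //; lia.
apply/partial_sumsP; exists j; first by rewrite size_cat; lia.
by rewrite take_cat; case: ifP => //; lia.
Qed.

Lemma rgt_partial_sums (u v : word) :
  rgt (wsum u) (partial_sums (u ++ v)) = partial_sums v.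
Proof.
apply/fsetP=> i; rewrite mem_rgt; apply/andP/partial_sumsP => [[i0]|[j jv ->]].
  case/partial_sumsP=> j jq; rewrite take_cat; case: ifP => [ju eq_i|ju].
    by have := wsum_take_le u j; rewrite -eq_i; lia.
  rewrite wsum_cat addnC => /addnI eq_i; exists (j - size u) => //.
  move: i0; rewrite eq_i wsum_gt0 size_take_min; move: jq; rewrite size_cat; lia.
split; first by rewrite wsum_gt0 size_take_min; lia.
apply/partial_sumsP; exists (j + size u); first by rewrite size_cat; lia.
by rewrite take_cat ifF ?addnK ?wsum_cat 1?addnC //; lia.
Qed.

(** The partial sums of [u ++ v] are those of the two parts and the cut [wsum u], so the cut may or
    may not belong to [D]. If [u] or [v] is empty, the cut is an end of the interval and the bound
    on [D] excludes it. *)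
Lemma sub_partial_sums_cat (u v : word) D : (D `<=` below (wsum u + wsum v))%fset ->
  (D `<=` partial_sums (u ++ v))%fset
    = (lft (wsum u) D `<=` partial_sums u)%fset
        && (rgt (wsum u) D `<=` partial_sums v)%fset.
Proof.
move=> /fsubsetP sD; apply/fsubsetP/andP => [sDq|[/fsubsetP sl /fsubsetP sr] i iD].
  split; apply/fsubsetP=> i.
    by rewrite -(lft_partial_sums u v) !mem_lft => /andP[/sDq-> ->].
  by rewrite -(rgt_partial_sums u v) !mem_rgt => /andP[-> /sDq->].
have [lt_iu|lt_ui|eq_i] := ltngtP i (wsum u).
- have : i \in partial_sums u by apply: sl; rewrite mem_lft iD.
  by rewrite -(lft_partial_sums u v) mem_lft => /andP[].
- have : i - wsum u \in partial_sums v.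
    by apply: sr; rewrite mem_rgt subn_gt0 lt_ui subnK ?iD ?(ltnW lt_ui).
  by rewrite -(rgt_partial_sums u v) mem_rgt subnK ?(ltnW lt_ui) // => /andP[].
have := sD i iD; rewrite mem_below eq_i => lt_u; apply/partial_sumsP.
exists (size u); last by rewrite take_size_cat.
by rewrite size_cat -wsum_gt0 -[size v]addn0; have := wsum_gt0 v; lia.
Qed.

Lemma word_eqE (q r : word) :
  (q == r) = (wsum q == wsum r) && (partial_sums q == partial_sums r).
Proof.
apply/eqP/andP => [->|[/eqP eq_w /eqP eq_p]]; first by rewrite !eqxx.
by rewrite -(comp_of_partial_sums q) eq_w eq_p comp_of_partial_sums.
Qed.

End Cutting.

(** * Descent and peak indices of permutations of arbitrary degree *)

Definition perm_Des (x : perms) : {fset nat} := Des (tagged x).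
Definition perm_Peak (x : perms) : {fset nat} := Peak (tagged x).

Lemma perm_Des_below x : (perm_Des x `<=` below (tag x))%fset.
Proof. exact: Des_below. Qed.

Lemma perm_PeakE x : perm_Peak x = peaks_of (perm_Des x).
Proof. exact: Peak_Des. Qed.

Definition descent_word (x : perms) : word := comp_of (tag x) (perm_Des x).

Lemma Peak_is_peak_set (x : perms) : is_peak_set (tag x) (perm_Peak x).
Proof. by rewrite perm_PeakE peaks_of_peak_set ?perm_Des_below. Qed.

Definition peak_index (x : perms) : peakset :=
  exist _ (tag x, perm_Peak x) (Peak_is_peak_set x).

Lemma descent_wordE (x : perms) q :
  (descent_word x == q)
    = (tag x == wsum q) && (perm_Des x == partial_sums q).
Proof. by rewrite word_eqE wsum_comp_of ?comp_ofK ?perm_Des_below. Qed.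

Lemma peak_indexE (x : perms) (P : peakset) :
  (peak_index x == P) = (tag x == (val P).1) && (perm_Peak x == (val P).2).
Proof. by rewrite -val_eqE. Qed.

Lemma descent_word_surj q : exists x, descent_word x = q.
Proof.
have [s Ds] := Des_realizable (partial_sums_below q).
by exists (perm_in s); rewrite /descent_word /perm_Des /= Ds comp_of_partial_sums.
Qed.

Lemma peak_index_surj P : exists x, peak_index x = P.
Proof.
have [s Ds] := Des_realizable (is_peak_set_below (valP P)).
exists (perm_in s); apply/eqP; rewrite peak_indexE /= perm_PeakE /perm_Des /= Ds.
by rewrite (peaks_ofK (valP P)) !eqxx.
Qed.

Lemma sum_eq_natr (R : pzSemiRingType) (T : choiceType) (r : seq T) (p : pred T) y :
  uniq r -> \sum_(z <- r | p z) (y == z)%:R = ((y \in r) && p y)%:R :> R.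
Proof.
move=> r_uniq; have [yr|yr] := boolP (y \in r); last first.
  rewrite big1_seq // => z /andP[_ zr]; case: eqP => // eq_yz.
  by rewrite eq_yz zr in yr.
rewrite big_mkcond (bigD1_seq y) //= eqxx big1 => [|z /negbTE].
  by rewrite addr0; case: (p y).
by rewrite eq_sym => ->; rewrite if_same.
Qed.

(** * Bases of the descent and peak algebras *)
Section GroupAlgebra.
Variable K : fieldType.
Implicit Types (x : perms).

Definition perm_sum n (p : pred perms) : KS K :=
  \sum_(s : 'S_n | p (perm_in s)) << perm_in s >>.

Lemma mcoeff_perm_sum n p x : (perm_sum n p)@_x = ((tag x == n) && p x)%:R.
Proof.
rewrite raddf_sum /=; case: x => m t /=; have [eq_mn|ne_mn] /= := eqVneq m n.
  case: n / eq_mn; under eq_bigr => s _ do rewrite mcoeffU.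
  rewrite big_mkcond (bigD1 t) //= eqxx big1 => [|s ne_st].
    by rewrite addr0; case: (p _).
  rewrite (_ : perm_in s == _ = false) ?if_same //.
  apply: contraNF ne_st; rewrite -/(perm_in t) -tag_eqE /tag_eq /=.
  by rewrite tagged_asE eqxx.
rewrite big1 // => s _; rewrite mcoeffU (_ : perm_in s == _ = false) //.
by apply: contraNF ne_mn => /eqP/(congr1 tag) /= ->.
Qed.

Lemma mcoeff_Delta_set n D x :
  (Delta_set K n D)@_x = ((tag x == n) && (perm_Des x == D))%:R.
Proof. exact: (mcoeff_perm_sum n (fun x => perm_Des x == D)). Qed.

Lemma mcoeff_Pi_set n P x :
  (Pi_set K n P)@_x = ((tag x == n) && (perm_Peak x == P))%:R.
Proof. exact: (mcoeff_perm_sum n (fun x => perm_Peak x == P)). Qed.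

Lemma mcoeff_Delta q x : (Delta K q)@_x = (descent_word x == q)%:R.
Proof. by rewrite mcoeff_Delta_set descent_wordE. Qed.

Lemma mcoeff_Pi P x : (Pi K P)@_x = (peak_index x == P)%:R.
Proof. by rewrite mcoeff_Pi_set peak_indexE. Qed.

Lemma sum_fpowerset_eq (D E : {fset nat}) :
  \sum_(z <- fpowerset D) (E == z)%:R = (E `<=` D)%fset%:R :> K.
Proof. by rewrite sum_eq_natr ?fset_uniq // fpowersetE andbT. Qed.

Lemma mcoeff_Xi q x :
  (Xi K q)@_x
    = ((tag x == wsum q) && (perm_Des x `<=` partial_sums q)%fset)%:R.
Proof.
rewrite /Xi /Xi_set raddf_sum /= -mulnb natrM -sum_fpowerset_eq mulr_sumr.
by apply: eq_bigr => E _; rewrite mcoeff_Delta_set -natrM mulnb.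
Qed.

Lemma freeb_coef (I J : choiceType) (b : I -> {malg K[J]}) (x : I -> J)
    (rk : I -> nat) :
  (forall i, (b i)@_(x i) != 0) ->
  (forall i j, i != j -> (rk i <= rk j)%N -> (b j)@_(x i) = 0) -> freeb b.
Proof.
apply: (@freeb_triangular K I _ b (fun i v => v@_(x i)) rk) => i a u v.
by rewrite mcoeffD mcoeffZ.
Qed.

Lemma Delta_free : freeb (Delta K).
Proof.
have [x xP] := choice descent_word_surj.
apply: (@freeb_coef _ _ _ x (fun=> 0%N)) => [q|q r ne_qr _].
  by rewrite mcoeff_Delta xP eqxx oner_eq0.
by rewrite mcoeff_Delta xP (negbTE ne_qr).
Qed.

Lemma Pi_free : freeb (Pi K).
Proof.
have [x xP] := choice peak_index_surj.
apply: (@freeb_coef _ _ _ x (fun=> 0%N)) => [q|q r ne_qr _].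
  by rewrite mcoeff_Pi xP eqxx oner_eq0.
by rewrite mcoeff_Pi xP (negbTE ne_qr).
Qed.

(** Makes the truncated subtraction in the rank used by [Xi_free] exact. *)
Lemma card_partial_sums_le q : (#|` partial_sums q| <= wsum q)%N.
Proof.
apply: leq_trans (fsubset_leq_card (partial_sums_below q)) _.
rewrite card_fseq undup_id ?iota_uniq // size_iota; lia.
Qed.

(** A permutation with descent word [q] occurs in [Xi r] only if the partial sums of [q] are among
    those of [r]. The rank is lower for larger sets, so the system is triangular. *)
Lemma Xi_free : freeb (Xi K).
Proof.
have [x xP] := choice descent_word_surj.
have xE q : tag (x q) = wsum q /\ perm_Des (x q) = partial_sums q.
  by have := descent_wordE (x q) q; rewrite xP eqxx => /esym/andP[/eqP ? /eqP].
apply: (@freeb_coef _ _ _ x (fun q => (wsum q - #|` partial_sums q|)%N)).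
  by move=> q; have [tq Dq] := xE q; rewrite mcoeff_Xi tq Dq eqxx fsubset_refl oner_eq0.
move=> q r ne_qr le_qr; have [tq Dq] := xE q; rewrite mcoeff_Xi tq Dq.
case: andP => // -[/eqP eq_w sub_qr]; case/eqP: ne_qr; apply/eqP.
rewrite word_eqE eq_w eqxx /= eqEfcard sub_qr /=.
have := card_partial_sums_le q; have := card_partial_sums_le r.
move: le_qr eq_w => /=; set a := #|` _|; set b := #|` _|.
by move: (wsum q) (wsum r) a b; lia.
Qed.

Lemma Delta_comp_of n D : (D `<=` below n)%fset ->
  Delta K (comp_of n D) = Delta_set K n D.
Proof. by move=> sD; rewrite /Delta wsum_comp_of // comp_ofK. Qed.

Definition Xi_coord q : {malg K[word]} :=
  \sum_(E <- fpowerset (partial_sums q)) << comp_of (wsum q) E >>.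

Lemma Xi_lincomb q : Xi K q = lincomb (Xi_coord q) (Delta K).
Proof.
rewrite lincomb_sum; apply: eq_big_seq => E; rewrite fpowersetE => sE.
by rewrite lincombU Delta_comp_of // (fsubset_trans sE) ?partial_sums_below.
Qed.

(** [Xi] of a set is [Delta] of the same set plus terms for proper subsets; induction on the
    cardinality inverts this without naming the signs. *)
Lemma Delta_lincomb_Xi q : exists c, Delta K q = lincomb c (Xi K).
Proof.
rewrite -(comp_of_partial_sums q); have := partial_sums_below q.
move: (wsum q) (partial_sums q) => n D.
have [m] := ubnP #|` D|; elim: m D => // m IHm D ltDm sD.
have Xi_D : Xi K (comp_of n D)
    = Delta_set K n D + \sum_(E <- fpowerset D | E != D) Delta_set K n E.
  rewrite /Xi /Xi_set wsum_comp_of // comp_ofK // [LHS](bigD1_seq D) //=.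
    by rewrite fpowersetE.
  exact: fset_uniq.
rewrite Delta_comp_of //.
suff [c eq_c] : exists c, \sum_(E <- fpowerset D | E != D) Delta_set K n E
    = lincomb c (Xi K).
  exists (<< comp_of n D >> - c).
  by rewrite lincombD lincombN lincombU -eq_c Xi_D addrK.
rewrite big_seq_cond; apply: (big_ind (fun v => exists c, v = lincomb c (Xi K))).
- by exists 0; rewrite lincomb0.
- by move=> _ _ [c ->] [d ->]; exists (c + d); rewrite lincombD.
move=> E; rewrite fpowersetE => /andP[sE ne_ED].
have sEn : (E `<=` below n)%fset by apply: fsubset_trans sE sD.
have ltED : (#|` E| < #|` D|)%N.
  by apply: fproper_ltn_card; rewrite fproperEneq ne_ED.
by rewrite -Delta_comp_of //; apply: IHm => //; apply: leq_trans ltED _.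
Qed.

(** The value of [star] at [Delta q] and [Delta r], as [star_Delta_lincomb] shows: both parts of the
    word have prescribed descents and the cut is free. *)
Definition Delta_star q r : KS K :=
  perm_sum (wsum q + wsum r) (fun x =>
    (lft (wsum q) (perm_Des x) == partial_sums q)
      && (rgt (wsum q) (perm_Des x) == partial_sums r)).

(** By [sub_partial_sums_cat] the inclusion that defines [Xi (q ++ r)] splits into one for each
    part; each is then expanded over the possible descent sets. *)
Lemma Xi_cat q r : Xi K (q ++ r)
  = lincomb (Xi_coord q) (fun i => lincomb (Xi_coord r) (Delta_star i)).
Proof.
rewrite lincomb_sum; apply/malgP=> x; rewrite mcoeff_Xi raddf_sum /= wsum_cat.
have [tx|ne_t] := eqVneq (tag x); last first.
  rewrite big1_seq // => E; rewrite fpowersetE /= => sE; rewrite lincombU.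
  rewrite lincomb_sum raddf_sum /= big1_seq // => G; rewrite fpowersetE /= => sG.
  rewrite lincombU mcoeff_perm_sum !wsum_comp_of ?(negbTE ne_t) //.
    by apply: fsubset_trans sG (partial_sums_below r).
  by apply: fsubset_trans sE (partial_sums_below q).
rewrite /= sub_partial_sums_cat -?tx ?perm_Des_below // -mulnb natrM.
rewrite -!sum_fpowerset_eq mulr_suml; apply: eq_big_seq => E.
rewrite fpowersetE => sE; rewrite lincombU lincomb_sum raddf_sum mulr_sumr.
apply: eq_big_seq => G; rewrite fpowersetE => sG /=.
have sEn : (E `<=` below (wsum q))%fset.
  by apply: fsubset_trans sE (partial_sums_below q).
have sGn : (G `<=` below (wsum r))%fset.
  by apply: fsubset_trans sG (partial_sums_below r).
rewrite lincombU mcoeff_perm_sum !wsum_comp_of // !comp_ofK // tx eqxx.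
by rewrite -natrM mulnb.
Qed.

(** [Xi_cat] says that [star] agrees on the basis [Xi] with the bilinear extension of [Delta_star];
    since [Delta] spans the same space, they agree on it too. *)
Lemma star_Delta_lincomb c d :
  star (lincomb c (Delta K)) (lincomb d (Delta K))
    = lincomb c (fun q => lincomb d (Delta_star q)).
Proof.
have star_Xi u v : star (lincomb u (Xi K)) (lincomb v (Xi K))
    = extend2 (Delta K) (Delta K) Delta_star
        (lincomb u (Xi K)) (lincomb v (Xi K)).
  rewrite /star extend2_lincomb; [|exact: Xi_free..].
  have XiE w : lincomb w (Xi K) = lincomb (lincomb w Xi_coord) (Delta K).
    by rewrite lincomb_lincomb; apply: eq_lincomb => q; exact: Xi_lincomb.
  rewrite !XiE extend2_lincomb; [|exact: Delta_free..].
  rewrite lincomb_lincomb; apply: eq_lincomb => q.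
  under eq_lincomb => r do rewrite Xi_cat.
  rewrite lincomb_exchange; apply: eq_lincomb => r.
  by rewrite lincomb_lincomb.
have [a aP] := choice Delta_lincomb_Xi.
have DeltaE w : lincomb w (Delta K) = lincomb (lincomb w a) (Xi K).
  by rewrite lincomb_lincomb; apply: eq_lincomb => q; exact: aP.
rewrite [in LHS]DeltaE [in X in star _ X]DeltaE star_Xi -!DeltaE.
by rewrite extend2_lincomb //; exact: Delta_free.
Qed.

Definition Pi_coord (P : peakset) : {malg K[word]} :=
  \sum_(D <- fpowerset (below (val P).1) | peaks_of D == (val P).2)
     << comp_of (val P).1 D >>.

Lemma Pi_lincomb P : Pi K P = lincomb (Pi_coord P) (Delta K).
Proof.
rewrite lincomb_sum; apply/malgP=> x; rewrite mcoeff_Pi_set raddf_sum /=.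
rewrite big_seq_cond (eq_bigr (fun D =>
  (tag x == (val P).1)%:R * (perm_Des x == D)%:R)) => [|D]; last first.
  rewrite fpowersetE => /andP[sD _].
  by rewrite lincombU Delta_comp_of // mcoeff_Delta_set -natrM mulnb.
rewrite -big_seq_cond -mulr_sumr sum_eq_natr ?fset_uniq // fpowersetE -natrM.
rewrite mulnb -perm_PeakE; case: eqP => //= <-; by rewrite perm_Des_below.
Qed.

Definition Pi_star (P Q : peakset) : KS K :=
  perm_sum ((val P).1 + (val Q).1) (fun x =>
    (lft (val P).1 (perm_Peak x) == (val P).2)
      && (rgt_peaks (val P).1 (perm_Peak x) == (val Q).2)).

(** Cutting commutes with taking peaks, so the sum of [Delta_star] over all descent sets with the
    prescribed peaks is again one sum over words. *)
Lemma star_Pi_lincomb c d :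
  star (lincomb c (Pi K)) (lincomb d (Pi K))
    = lincomb c (fun P => lincomb d (Pi_star P)).
Proof.
have PiE w : lincomb w (Pi K) = lincomb (lincomb w Pi_coord) (Delta K).
  by rewrite lincomb_lincomb; apply: eq_lincomb => q; exact: Pi_lincomb.
rewrite !PiE star_Delta_lincomb lincomb_lincomb; apply: eq_lincomb => P.
under eq_lincomb => q do rewrite lincomb_lincomb.
rewrite lincomb_exchange; apply: eq_lincomb => Q.
rewrite lincomb_sum; apply/malgP=> s; rewrite mcoeff_perm_sum raddf_sum /=.
have [ts|ne_t] /= := eqVneq (tag s); last first.
  rewrite big_seq_cond big1 // => E; rewrite fpowersetE => /andP[sE _].
  rewrite lincombU lincomb_sum raddf_sum /= big_seq_cond big1 // => G.
  rewrite fpowersetE => /andP[sG _].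
  by rewrite lincombU mcoeff_perm_sum !wsum_comp_of ?(negbTE ne_t).
have sDs := perm_Des_below s.
rewrite perm_PeakE -peaks_of_lft -peaks_of_rgt -mulnb natrM.
(* For a fixed word exactly one pair [E], [G] matches its two descent sets, so the double sum is a
   product of two indicators. *)
transitivity (\sum_(E <- fpowerset (below (val P).1) | peaks_of E == (val P).2)
  \sum_(G <- fpowerset (below (val Q).1) | peaks_of G == (val Q).2)
    (lft (val P).1 (perm_Des s) == E)%:R * (rgt (val P).1 (perm_Des s) == G)%:R : K);
  last first.
  under eq_bigr => E _ do rewrite -mulr_sumr.
  rewrite -mulr_suml !sum_eq_natr ?fset_uniq // !fpowersetE.
  rewrite (lft_below _ sDs); have := rgt_below (val P).1 sDs.
  by rewrite ts addKn => ->.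
rewrite big_seq_cond [RHS]big_seq_cond; apply: eq_bigr => E.
rewrite fpowersetE => /andP[sE _]; rewrite lincombU lincomb_sum raddf_sum /=.
rewrite big_seq_cond [RHS]big_seq_cond; apply: eq_bigr => G.
rewrite fpowersetE => /andP[sG _].
rewrite lincombU mcoeff_perm_sum !wsum_comp_of // !comp_ofK // ts eqxx.
by rewrite -natrM mulnb.
Qed.

Lemma Pi_set_lincomb n P : exists c, Pi_set K n P = lincomb c (Pi K).
Proof.
have [P_peak|P_npeak] := boolP (is_peak_set n P).
  exists << exist _ (n, P) P_peak >>; rewrite lincombU; exact: erefl.
(* If [P] is not a peak set, no permutation has [P] as its set of peaks and the sum is empty. *)
exists 0; rewrite lincomb0; apply/malgP=> x; rewrite mcoeff_Pi_set mcoeff0.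
case: andP => // -[/eqP tx /eqP Px]; case/negP: P_npeak.
by rewrite -tx -Px Peak_is_peak_set.
Qed.

(** The condition on a word involves only its peak set, so [Pi_star] is a sum of elements [Pi_set].
    This gives closure under [star]. *)
Lemma Pi_star_lincomb P Q : exists c, Pi_star P Q = lincomb c (Pi K).
Proof.
have [c cP] := choice (Pi_set_lincomb ((val P).1 + (val Q).1)).
exists (\sum_(D <- fpowerset (below ((val P).1 + (val Q).1))
  | (lft (val P).1 D == (val P).2) && (rgt_peaks (val P).1 D == (val Q).2)) c D).
apply/malgP=> x; rewrite mcoeff_perm_sum lincomb_sum raddf_sum /=.
under eq_bigr => D _ do rewrite -cP mcoeff_Pi_set -mulnb natrM.
rewrite -mulr_sumr sum_eq_natr ?fset_uniq // -natrM mulnb fpowersetE.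
by case: eqP => //= <-; rewrite is_peak_set_below ?Peak_is_peak_set.
Qed.

Lemma peak_algebra_star (phi psi : KS K) :
  peak_algebra phi -> peak_algebra psi -> peak_algebra (star phi psi).
Proof.
move=> /span_rangeP[x ->] /span_rangeP[y ->]; rewrite star_Pi_lincomb.
have [c cP] := choice (fun PQ => Pi_star_lincomb PQ.1 PQ.2).
apply/span_rangeP; exists (lincomb x (fun P => lincomb y (fun Q => c (P, Q)))).
rewrite lincomb_lincomb; apply: eq_lincomb => P; rewrite lincomb_lincomb.
by apply: eq_lincomb => Q; exact: (cP (P, Q)).
Qed.

End GroupAlgebra.

(** * Quasi-symmetric functions and the kernel *)
Section Monomials.
Local Open Scope nat_scope.

Lemma expcmnE (m : {cmonom nat}) n k : expcmn m n k = n * m k.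
Proof.
case: n => [|n]; first by rewrite mul0n cm1.
rewrite /expcmn iteropS; elim: n => [|n IHn]; first by rewrite mul1n.
by rewrite iterS mulcmE IHn mulSn.
Qed.

Lemma monomial_cons a i p (r : word) k :
  monomial (a :: i) (p :: r) k = (a == k) * val p + monomial i r k.
Proof. by rewrite /monomial /= big_cons cmM expcmnE cmU mulnC. Qed.

Lemma monomial_nil i k : monomial i [::] k = 0.
Proof. by rewrite /monomial; case: i => [|a i]; rewrite big_nil cm1. Qed.

Lemma monomial_gt0 i (r : word) k :
  size i = size r -> (0 < monomial i r k) = (k \in i).
Proof.
elim: i r => [|a i IHi] [|p r] //= => [_|[szi]]; first by rewrite monomial_nil.
rewrite monomial_cons inE addn_gt0 IHi // muln_gt0 (valP p) andbT.
by rewrite eq_sym; case: (k == a).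
Qed.

Lemma monomial_exp_inj i (r r' : word) : uniq i -> size i = size r ->
  size i = size r' -> monomial i r =1 monomial i r' -> r = r'.
Proof.
elim: i r r' => [|a i IHi] [|p r] [|p' r'] //= /andP[ai i_uniq] [szr] [szr'] eq_m.
have eq0 (s : word) : size i = size s -> monomial i s a = 0.
  by move=> szs; apply/eqP; rewrite -leqn0 leqNgt monomial_gt0 // (negbTE ai).
congr (_ :: _).
  have := eq_m a; rewrite !monomial_cons eqxx !mul1n !eq0 // !addn0; exact: val_inj.
apply: IHi => // k; have [<-|ne_ak] := eqVneq a k; first by rewrite !eq0.
by have := eq_m k; rewrite !monomial_cons (negbTE ne_ak).
Qed.

(** The support of the monomial, listed increasingly, recovers the indices; evaluation at these
    recovers the exponents. *)
Lemma monomial_inj i i' (r r' : word) : sorted ltn i -> sorted ltn i' ->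
  size i = size r -> size i' = size r' -> monomial i r = monomial i' r' -> r = r'.
Proof.
move=> si si' szi szi' eq_m; have eq_i : i = i'.
  apply: (irr_sorted_eq ltn_trans ltnn si si') => k.
  by rewrite -(monomial_gt0 k szi) eq_m monomial_gt0.
move: eq_m; rewrite -eq_i => eq_m; apply: (@monomial_exp_inj i).
- exact: sorted_uniq ltn_trans ltnn _ si.
- exact: szi.
- by rewrite eq_i.
- by rewrite eq_m.
Qed.

(** The monomial of [M r] in the first variables. Among all [M q] it occurs only in [M r], so its
    coefficient is a coordinate functional. *)
Definition packed_monomial (r : word) := monomial (iota 0 (size r)) r.

End Monomials.

Section PairingWithPeaks.
Variable K : fieldType.

Lemma M_packed r q : M K r (packed_monomial q) = (q == r)%:R.
Proof.
rewrite /M; congr (nat_of_bool _)%:R; apply/asboolP/eqP => [[i [si szi]]|->].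
  by apply: monomial_inj; rewrite ?size_iota ?iota_ltn_sorted.
by exists (iota 0 (size r)); rewrite size_iota iota_ltn_sorted.
Qed.

Lemma M_free : freeb (M K).
Proof.
apply: (@freeb_triangular K _ _ (M K) (fun q f => f (packed_monomial q))
  (fun=> 0%N)) => [q a f g|q|q r ne_qr _] //.
  by rewrite M_packed eqxx oner_eq0.
by rewrite M_packed (negbTE ne_qr).
Qed.

Definition F_coord (q : word) : {malg K[word]} :=
  \sum_(r <- compositions (wsum q) | (partial_sums q `<=` partial_sums r)%fset)
    << r >>.

Lemma F_lincomb q : F K q = lincomb (F_coord q) (M K).
Proof. by rewrite lincomb_sum; apply: eq_bigr => r _; rewrite lincombU. Qed.

Lemma mcoeff_F_coord q r : (F_coord q)@_r
  = ((wsum r == wsum q) && (partial_sums q `<=` partial_sums r)%fset)%:R.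
Proof.
rewrite raddf_sum /=; under eq_bigr => s _ do rewrite mcoeffU eq_sym.
by rewrite sum_eq_natr ?compositions_uniq // mem_compositions.
Qed.

(** [F q] is [M q] plus terms [M r] with more partial sums, which is triangular for their number. *)
Lemma F_free : freeb (F K).
Proof.
have -> : F K = (fun q => lincomb (F_coord q) (M K)) by apply/funext/F_lincomb.
apply: freeb_comp; first exact: M_free.
apply: (@freeb_coef _ _ _ _ id (fun q => #|` partial_sums q|)) => [q|q r ne_qr le_qr].
  by rewrite mcoeff_F_coord eqxx fsubset_refl oner_eq0.
rewrite mcoeff_F_coord; case: andP => // -[/eqP eq_w sub_rq].
case/eqP: ne_qr; apply/esym/eqP.
by rewrite word_eqE eq_w eqxx /= eqEfcard sub_rq.
Qed.

Definition peak_norm (P : peakset) : K :=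
  if (val P).1 is 0 then 1 else 2%:R ^+ (#|` (val P).2|).+1.

Lemma Kpeak_normE P : Kpeak_norm K P = peak_norm P *: Kpeak K P.
Proof. by rewrite /Kpeak_norm /peak_norm; case: (val P) => -[]. Qed.

Lemma KpeakE P : Kpeak K P = \sum_(D <- fpowerset (below (val P).1)
  | ((val P).2 `<=` xor_shift D)%fset) F_set K (val P).1 D.
Proof. by rewrite /Kpeak; case: (val P). Qed.

Definition Kpeak_coord (P : peakset) : {malg K[word]} :=
  \sum_(D <- fpowerset (below (val P).1) | ((val P).2 `<=` xor_shift D)%fset)
    << comp_of (val P).1 D >>.

Lemma Kpeak_lincomb P : Kpeak K P = lincomb (Kpeak_coord P) (F K).
Proof. by rewrite KpeakE lincomb_sum; apply: eq_bigr => D _; rewrite lincombU. Qed.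

Lemma Kpeak_norm_lincomb P :
  Kpeak_norm K P = lincomb (peak_norm P *: Kpeak_coord P) (F K).
Proof. by rewrite lincombZ -Kpeak_lincomb Kpeak_normE. Qed.

Lemma mcoeff_Kpeak_coord P q : (Kpeak_coord P)@_q
  = ((wsum q == (val P).1) && ((val P).2 `<=` xor_shift (partial_sums q))%fset)%:R.
Proof.
rewrite raddf_sum /= big_seq_cond.
under eq_bigr => D.
  rewrite fpowersetE => /andP[sD _]; rewrite mcoeffU eq_sym word_eqE.
  rewrite wsum_comp_of // comp_ofK // -[1 *+ _]/(_%:R) -mulnb natrM; over.
rewrite -big_seq_cond -mulr_sumr sum_eq_natr ?fset_uniq // -natrM mulnb.
by rewrite fpowersetE; case: eqP => //= <-; rewrite partial_sums_below.
Qed.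

(** Prefix parities solve the equation that [D] xor [D + 1] equals [P] at the positions strictly
    between 1 and [n]. *)
Definition parity_set n (P : {fset nat}) : {fset nat} :=
  [fset i in below n | \big[addb/false]_(j < i.+1) ((j : nat) \in P)]%fset.

Lemma mem_xor_shift_parity_set n P i : (1 < i < n)%N ->
  (i \in xor_shift (parity_set n P)) = (i \in P).
Proof.
case/andP=> i1 lt_in.
have memP j : (0 < j < n)%N ->
    (j \in parity_set n P) = \big[addb/false]_(l < j.+1) ((l : nat) \in P).
  by move=> lt_j; rewrite !inE /= mem_index_iota lt_j.
have i0 : (0 < i)%N by apply: ltnW.
rewrite mem_xor_shift i0 (memP i) ?i0 // memP; last by lia.
by rewrite prednK // big_ord_recr /=; case: (\big[_/_]_(_ < _) _); case: (_ \in _).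
Qed.

(** At the parity set of [P], the coefficient of [Kpeak Q] in the same degree is nonzero only for
    [Q] inside [P]: a triangular system for the number of peaks. *)
Lemma Kpeak_free : freeb (Kpeak K).
Proof.
have -> : Kpeak K = (fun P => lincomb (Kpeak_coord P) (F K)).
  exact/funext/Kpeak_lincomb.
apply: freeb_comp; first exact: F_free.
pose D (P : peakset) := parity_set (val P).1 (val P).2.
have sD P : (D P `<=` below (val P).1)%fset.
  by apply/fsubsetP=> i; rewrite !inE => /andP[].
have memD (P Q : peakset) i : (val P).1 = (val Q).1 -> i \in (val Q).2 ->
    (i \in xor_shift (D P)) = (i \in (val P).2).
  have /is_peak_setP[sQ _] := valP Q.
  by move=> eq_PQ /sQ lt_i; rewrite mem_xor_shift_parity_set ?eq_PQ.
apply: (@freeb_coef _ _ _ _ (fun P => comp_of (val P).1 (D P))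
  (fun P => #|` (val P).2|)) => [P|P Q ne_PQ le_PQ].
  rewrite mcoeff_Kpeak_coord wsum_comp_of // comp_ofK // eqxx /=.
  rewrite (_ : fsubset _ _) ?oner_eq0 //.
  by apply/fsubsetP=> i iP; rewrite (memD P P).
rewrite mcoeff_Kpeak_coord wsum_comp_of // comp_ofK //.
case: andP => // -[/eqP eq_n /fsubsetP sQ]; case/eqP: ne_PQ; apply/val_inj.
rewrite [LHS]surjective_pairing [RHS]surjective_pairing eq_n; congr (_, _).
apply/esym/eqP; rewrite eqEfcard le_PQ andbT; apply/fsubsetP=> i iQ.
by rewrite -(memD P Q) // sQ.
Qed.

Hypothesis charK : [pchar K] =i pred0.

(** Characteristic 0 enters here, as the invertibility of 2. *)
Lemma peak_norm_neq0 P : peak_norm P != 0.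
Proof.
rewrite /peak_norm; case: (val P).1 => [|_]; first exact: oner_neq0.
apply: expf_neq0; apply: contraFneq (charK 2) => K2.
by rewrite !inE /= K2 eqxx.
Qed.

Lemma Kpeak_norm_free : freeb (Kpeak_norm K).
Proof.
have -> : Kpeak_norm K = (fun P => lincomb (peak_norm P *: << P >>) (Kpeak K)).
  by apply/funext => P; rewrite lincombZ lincombU Kpeak_normE.
apply: freeb_comp; first exact: Kpeak_free.
apply: (@freeb_coef _ _ _ _ id (fun=> 0%N)) => [P|P Q ne_PQ _].
  by rewrite mcoeffZ mcoeffUU mulr1 peak_norm_neq0.
by rewrite mcoeffZ mcoeffU eq_sym (negbTE ne_PQ) mulr0.
Qed.

Lemma stembridgeP f :
  stembridge f <-> exists c, f = lincomb c (Kpeak_norm K).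
Proof.
split=> [/span_rangeP[c ->]|[c ->]].
  exists (lincomb c (fun P => (peak_norm P)^-1 *: << P >>)).
  rewrite lincomb_lincomb; apply: eq_lincomb => P; rewrite lincombZ lincombU.
  by rewrite Kpeak_normE scalerA mulVf ?scale1r // peak_norm_neq0.
apply/span_rangeP; exists (lincomb c (fun P => peak_norm P *: << P >>)).
rewrite lincomb_lincomb; apply: eq_lincomb => P; rewrite lincombZ lincombU.
by rewrite Kpeak_normE.
Qed.

Lemma pairing_lincomb u v : pairing (lincomb u (Delta K)) (lincomb v (F K))
  = lincomb u (fun q => v@_q : K^o).
Proof.
rewrite /pairing extend2_lincomb; [|exact: Delta_free|exact: F_free].
by apply: (@eq_lincomb _ _ K^o) => q; exact: lincomb_delta.
Qed.

Lemma pairing_lincomb_Kpeak_norm c P :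
  pairing (lincomb c (Delta K)) (Kpeak_norm K P)
    = peak_norm P * lincomb c (fun q => (Kpeak_coord P)@_q : K^o).
Proof.
rewrite Kpeak_norm_lincomb pairing_lincomb -[RHS](@lincomb_gZ _ _ K^o).
by apply: (@eq_lincomb _ _ K^o) => q; rewrite mcoeffZ.
Qed.

Lemma inner_perm (s x : perms) (psi : KS K) : (inner << s >> psi)@_x
  = \sum_(t : 'S_(tag s)) psi@_(perm_in t) * (perm_in (tagged s * t)%g == x)%:R.
Proof.
rewrite /inner msuppU oner_eq0 big_seq_fset1 raddf_sum /=.
by apply: eq_bigr => t _; rewrite mcoeffU mcoeffUU mul1r mulr_natr.
Qed.

Lemma perm_in_eq n (s t : 'S_n) : (perm_in s == perm_in t) = (s == t).
Proof. by rewrite -tag_eqE /tag_eq /= tagged_asE eqxx. Qed.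

(** The factor 2 of [Xi_tilde] is the count of [card_vperm]. In degree 0 there is just one function
    [A], in accordance with the exceptional value of [Xi_tilde]. *)
Lemma mcoeff_Xi_tilde n (t : 'S_n) :
  (Xi_tilde K n)@_(perm_in t)
    = #|[set A : {ffun 'I_n -> bool} | vperm A == t^-1%g]%SET|%:R.
Proof.
case: n t => [|n] t /=.
  rewrite mcoeffU (_ : perm_in _ == _); last first.
    by apply/eqP; congr perm_in; apply/permP => -[].
  congr (_%:R); apply/esym/eqP/cards1P; exists [ffun _ => true].
  apply/setP => A; rewrite !inE; apply/eqP/eqP => _; last by apply/permP => -[].
  by apply/ffunP => -[].
rewrite card_vperm invgK mcoeffZ mcoeff_Pi_set eqxx /perm_Peak /=.
by case: eqP => _; rewrite ?mulr1 ?mulr0.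
Qed.

(** Factorisations [w = s * t] with [t^-1 = vperm A] correspond to the sets [A], by
    [s = w * vperm A]. So the coefficient of [w] counts the [A] for which this [s] has descent set
    [D]. *)
Lemma iota_Delta q x : (iota_Xi (Delta K q))@_x
  = peak_norm (peak_index x) * (Kpeak_coord (peak_index x))@_q.
Proof.
rewrite mcoeff_Kpeak_coord /= /Delta /Delta_set /iota_Xi lincomb_sum raddf_sum /=.
under eq_bigr => s _ do rewrite lincombU inner_perm /=.
have [eq_w|ne_w] /= := eqVneq (wsum q) (tag x); last first.
  rewrite mulr0 big1 // => s _; rewrite big1 // => t _.
  rewrite (_ : perm_in _ == x = false) ?mulr0 //.
  by apply: contraNF ne_w => /eqP <-.
have := partial_sums_below q.
move: (wsum q) (partial_sums q) eq_w => n D; case: x => m w /= eq_w.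
case: m / eq_w w => w sD; rewrite -[existT _ _ _]/(perm_in w) /perm_Peak /=.
transitivity (#|[set A | Des (w * vperm A)%g == D]%SET|%:R : K); last first.
  (* Degree 0 is separate: the empty word has no valley, there is one function [A], and [peak_norm]
     is 1. *)
  have [n0|n_gt0] := posnP n.
    subst n; have -> : D = fset0 by exact: below0.
    have P0 : Peak w = fset0.
      apply: below0; rewrite Peak_Des.
      by rewrite is_peak_set_below ?peaks_of_peak_set ?Des_below.
    rewrite P0 fsub0set mulr1 /peak_norm /= -[RHS]/(1%:R); congr (_%:R).
    apply/eqP/cards1P; exists [ffun _ => true].
    apply/setP => A; rewrite !inE (below0 (Des_below _)) eqxx.
    by apply/esym/eqP/ffunP => -[].
  rewrite card_Des_mul_vperm // /peak_norm /=; case: n n_gt0 w {sD} => // n _ w.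
  by case: ifP => _; rewrite ?mulr1 ?mulr0 // natrX.
under eq_bigr => s _.
  under eq_bigr => t _ do rewrite perm_in_eq mcoeff_Xi_tilde.
  rewrite (bigD1 (s^-1 * w)%g) //= mulKVg eqxx mulr1 big1 => [|t ne_t]; last first.
    by rewrite -(inj_eq (mulgI s^-1)%g) mulKg (negbTE ne_t) mulr0.
  rewrite addr0 invMg invgK; over.
rewrite -natr_sum; congr (_%:R).
under eq_bigr => s _ do rewrite -sum1dep_card.
(* Double counting of the pairs of [s] and [A]: once [A] is fixed, at most one [s] remains. *)
rewrite (exchange_big_dep xpredT) //= -sum1dep_card.
rewrite [RHS]big_mkcond /=; apply: eq_bigr => A _.
have eq_s (s : 'S_n) : (vperm A == (w^-1 * s)%g) = (s == (w * vperm A)%g).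
  by rewrite -(inj_eq (mulgI w)) mulKVg eq_sym.
under eq_bigl => s do rewrite eq_s.
case: ifP => [DA|nDA].
  rewrite (big_pred1 (w * vperm A)%g) // => s.
  by apply/andP/eqP => [[_ /eqP]|->] //; split; rewrite // eqxx.
by rewrite big_pred0 // => s; apply/andP => -[Ds /eqP eq_s']; rewrite -eq_s' Ds in nDA.
Qed.

Lemma mcoeff_iota phi x : descent_algebra phi ->
  (iota_Xi phi)@_x = pairing phi (Kpeak_norm K (peak_index x)).
Proof.
move=> /span_rangeP[c ->]; rewrite pairing_lincomb_Kpeak_norm.
rewrite /iota_Xi lincomb_lincomb mcoeff_lincomb -[RHS](@lincomb_gZ _ _ K^o).
by apply: (@eq_lincomb _ _ K^o) => q; exact: iota_Delta.
Qed.

Lemma pairing_sum c d : pairing (lincomb c (Delta K)) (lincomb d (Kpeak_norm K))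
  = lincomb d (fun P => pairing (lincomb c (Delta K)) (Kpeak_norm K P)).
Proof.
have -> : lincomb d (Kpeak_norm K)
    = lincomb (lincomb d (fun P => peak_norm P *: Kpeak_coord P)) (F K).
  by rewrite lincomb_lincomb; apply: eq_lincomb => P; exact: Kpeak_norm_lincomb.
rewrite pairing_lincomb.
under [RHS]eq_lincomb => P do rewrite Kpeak_norm_lincomb pairing_lincomb.
rewrite [RHS]lincomb_exchange; apply: (@eq_lincomb _ _ K^o) => q.
by rewrite mcoeff_lincomb.
Qed.

(** The coefficients of [iota_Xi phi] are the pairings of [phi] with the spanning family
    [Kpeak_norm], all of whose members occur by [peak_index_surj]. *)
Lemma ker_iotaE : ker_iota = stembridge_perp :> set (KS K).
Proof.
apply/seteqP; split=> phi [D_phi H]; split=> //.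
  move=> f /stembridgeP[d ->]; have /span_rangeP[c eq_phi] := D_phi.
  rewrite eq_phi pairing_sum -eq_phi -[RHS](lincomb_g0 K^o d).
  apply: eq_lincomb => P; have [x <-] := peak_index_surj P.
  by rewrite -mcoeff_iota // H mcoeff0.
apply/malgP=> x; rewrite mcoeff_iota // mcoeff0; apply: H.
by apply/stembridgeP; exists << peak_index x >>; rewrite lincombU.
Qed.

End PairingWithPeaks.

(** * The coproduct *)
Section CutPeaks.
Local Open Scope nat_scope.

(** Membership of [i] in [xor_shift D] depends on [i] and [i - 1] only, so a cut at [k] disturbs
    just the positions [k] and [k + 1]. *)
Lemma xor_shift_cut k n (P D : {fset nat}) : is_peak_set n P ->
  (P `<=` xor_shift D)%fset
    = [&& (lft k P `<=` xor_shift (lft k D))%fset,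
          (rgt_peaks k P `<=` xor_shift (rgt k D))%fset,
          (k \in P) ==> (k \in xor_shift D)
        & (k.+1 \in P) ==> (k.+1 \in xor_shift D)].
Proof.
case/is_peak_setP=> sP _.
have lftE i : i < k -> (i \in xor_shift (lft k D)) = (i \in xor_shift D).
  move=> lt_ik; rewrite !mem_xor_shift !mem_lft lt_ik andbT.
  by rewrite (leq_ltn_trans (leq_pred i) lt_ik) andbT.
have rgtE i : 1 < i -> (i \in xor_shift (rgt k D)) = (i + k \in xor_shift D).
  move=> i1; rewrite !mem_xor_shift !mem_rgt; case: i i1 => [|[|i]] //= _.
apply/fsubsetP/and4P => [sPD|[/fsubsetP sl /fsubsetP sr /implyP Pk /implyP Pk1] i iP].
  split; try exact/implyP/sPD; apply/fsubsetP=> i.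
    by rewrite mem_lft => /andP[/sPD iD lt_ik]; rewrite lftE.
  by rewrite mem_rgt_peaks => /andP[i1 /sPD]; rewrite rgtE.
have [lt_ik|le_ki] := ltnP i k; first by rewrite -lftE // sl // mem_lft iP.
have [eq_ik|ne_ik] := eqVneq i k; first by move: iP; rewrite eq_ik.
have [eq_ik|ne_ik1] := eqVneq i k.+1; first by move: iP; rewrite eq_ik.
have i_k : 1 < i - k by lia.
have ikK : i - k + k = i by lia.
by rewrite -ikK -rgtE // sr // mem_rgt_peaks i_k ikK.
Qed.

Lemma card_cut k (P : {fset nat}) :
  #|` P| = #|` lft k P| + #|` rgt_peaks k P| + (k \in P) + (k.+1 \in P).
Proof.
have -> : #|` lft k P| = count (fun i => i < k) P.
  rewrite -size_filter; apply/perm_size/uniq_perm.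
  - exact: fset_uniq.
  - by rewrite filter_uniq ?fset_uniq.
  by move=> i; rewrite mem_lft mem_filter andbC.
have -> : #|` rgt_peaks k P| = count (fun i => k.+1 < i) P.
  rewrite -size_filter -(size_map (subn^~ k)); apply/perm_size/uniq_perm.
  - exact: fset_uniq.
  - rewrite map_inj_in_uniq ?filter_uniq ?fset_uniq // => i j.
    by rewrite !mem_filter => /andP[lt_i _] /andP[lt_j _]; lia.
  move=> i; rewrite mem_rgt_peaks; apply/andP/mapP => [[i1 iP]|[j]].
    by exists (i + k); rewrite ?addnK // mem_filter iP andbT; lia.
  rewrite mem_filter => /andP[lt_j jP] ->; rewrite subnK ?jP //; lia.
rewrite -!(count_uniq_mem _ (fset_uniq P)) -!sum1_count -[LHS]sum1_size.
rewrite !(big_mkcond (fun i => _ < _)) !(big_mkcond (pred1 _)) -!big_split /=.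
apply: eq_bigr => i _.
by case: (ltngtP i k.+1) => lt_i; case: (ltngtP i k) => lt_i'; lia.
Qed.

(** The set with the given two parts that omits the cut point [k]. *)
Definition glue k (D E : {fset nat}) : {fset nat} :=
  (D `|` [fset (i + k)%N | i in E])%fset.

Lemma mem_glue k n D E i : (D `<=` below k)%fset -> (E `<=` below n)%fset ->
  (i \in glue k D E) = if i < k then i \in D else (k < i) && (i - k \in E).
Proof.
move=> /fsubsetP sD /fsubsetP sE; rewrite in_fsetU.
have -> : (i \in [fset (j + k)%N | j in E]%fset) = (k < i) && (i - k \in E).
  apply/imfsetP/andP => [[j /= jE ->]|[lt_ki iE]].
    by have := sE j jE; rewrite mem_below addnK jE => /andP[j0 _]; split=> //; lia.
  by exists (i - k) => //; rewrite subnK // ltnW.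
case: (ltnP i k) => [lt_ik|le_ki]; first by rewrite ltnNge (ltnW lt_ik) /= orbF.
rewrite (_ : i \in D = false) //; apply/negP => /sD; rewrite mem_below; lia.
Qed.

(** The two parts determine a set up to membership of [k], which is a choice only for interior
    [k]. *)
Lemma cut_eq_glue k n D E G : k <= n -> (G `<=` below n)%fset ->
  (D `<=` below k)%fset -> (E `<=` below (n - k))%fset ->
  (lft k G == D) && (rgt k G == E)
    = (G == glue k D E) || (0 < k < n) && (G == k |` glue k D E)%fset.
Proof.
move=> le_kn /fsubsetP sG sD sE; have memg i := mem_glue i sD sE.
have k_glue : k \notin glue k D E by rewrite memg !ltnn.
apply/andP/orP => [[/eqP eq_D /eqP eq_E]|].
  have eqG i : i != k -> (i \in G) = (i \in glue k D E).
    move=> ne_ik; rewrite memg -eq_D -eq_E mem_lft mem_rgt.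
    case: (ltngtP i k) ne_ik => //= lt_ik _; rewrite ?andbT //.
    by rewrite subn_gt0 lt_ik subnK // ltnW.
  have [kG|kG] := boolP (k \in G); [right|left].
    have := sG k kG; rewrite mem_below => -> /=; apply/eqP/fsetP=> i.
    by rewrite in_fset1U; case: (eqVneq i k) => [->|/eqG].
  apply/eqP/fsetP=> i; have [->|/eqG//] := eqVneq i k.
  by rewrite (negbTE kG) (negbTE k_glue).
have cutg H : (forall i, i != k -> (i \in H) = (i \in glue k D E)) ->
    lft k H == D /\ rgt k H == E.
  move=> eqH; split; apply/eqP/fsetP=> i.
    rewrite mem_lft; have [lt_ik|le_ki] := ltnP i k.
      by rewrite andbT eqH ?memg ?lt_ik // neq_ltn lt_ik.
    rewrite andbF; apply/esym/negP => /(fsubsetP sD); rewrite mem_below; lia.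
  rewrite mem_rgt; case: (posnP i) => [->|i0] /=.
    by apply/esym/negP => /(fsubsetP sE); rewrite mem_below.
  rewrite eqH ?memg; last by lia.
  rewrite ifF ?addnK; last by lia.
  by rewrite (_ : k < i + k) //; lia.
case=> [/eqP->|/andP[_ /eqP->]]; apply: cutg => // i ne_ik.
by rewrite in_fset1U (negbTE ne_ik).
Qed.

Lemma glue_below k n D E : k <= n ->
  (D `<=` below k)%fset -> (E `<=` below (n - k))%fset ->
  (glue k D E `<=` below n)%fset.
Proof.
move=> le_kn sD sE; apply/fsubsetP=> i; rewrite (mem_glue _ sD sE) mem_below.
case: ifP => [lt_ik /(fsubsetP sD)|_ /andP[lt_ki /(fsubsetP sE)]];
  rewrite mem_below; lia.
Qed.

End CutPeaks.

Definition peak_lft k (P : peakset) : peakset :=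
  exist _ (k, lft k (val P).2) (lft_peak_set k (valP P)).
Definition peak_rgt k (P : peakset) : peakset :=
  exist _ ((val P).1 - k, rgt_peaks k (val P).2)%N (rgt_peak_set k (valP P)).

Section Coproduct.
Variable K : fieldType.

(* The powers of 2 absorb the choice of whether the cut point [k] is a descent,
   which is free unless [k] or [k + 1] is a peak. *)
Lemma peak_norm_cut (P : peakset) k D E : (k <= (val P).1)%N ->
  (D `<=` below k)%fset -> (E `<=` below ((val P).1 - k))%fset ->
  peak_norm K P * \sum_(G <- fpowerset (below (val P).1)
       | ((val P).2 `<=` xor_shift G)%fset)
     ((lft k G == D) && (rgt k G == E))%:R
  = (peak_norm K (peak_lft k P) * (lft k (val P).2 `<=` xor_shift D)%fset%:R)
    * (peak_norm K (peak_rgt k P) * (rgt_peaks k (val P).2 `<=` xor_shift E)%fset%:R).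
Proof.
case: P => -[n P] /= P_peak; rewrite /peak_norm /= => le_kn sD sE.
have [/= sP P0] := is_peak_setP _ _ P_peak.
set a := (lft k P `<=` _)%fset; set b := (rgt_peaks k P `<=` _)%fset.
set D0 := glue k D E; set D1 := (k |` D0)%fset.
have sD0 : (D0 `<=` below n)%fset by exact: glue_below.
have memg i := mem_glue i sD sE.
have k_D0 : k \notin D0 by rewrite memg !ltnn.
pose f (G : {fset nat}) := (P `<=` xor_shift G)%fset.
(* Only the two gluings, without and with [k], have the parts [D] and [E]. *)
have -> : \sum_(G <- fpowerset (below n) | f G) ((lft k G == D) && (rgt k G == E))%:R
    = (f D0)%:R + ((0 < k < n)%N && f D1)%:R :> K.
  rewrite big_seq_cond.
  under eq_bigr => G.
    rewrite fpowersetE => /andP[sG _]; rewrite (cut_eq_glue le_kn sG sD sE).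
    rewrite (_ : (_ || _)%:R
      = (D0 == G)%:R + (0 < k < n)%N%:R * (D1 == G)%:R); last first.
      rewrite -/D0 -/D1 eq_sym [G == D1]eq_sym; case: eqP => [<-|_] /=; last first.
        by rewrite add0r -natrM mulnb.
      rewrite (_ : D1 == D0 = false) ?mulr0 ?addr0 //.
      by apply: contraNF k_D0 => /eqP <-; rewrite in_fset1U eqxx.
    over.
  rewrite -big_seq_cond big_split /= -mulr_sumr !sum_eq_natr ?fset_uniq //.
  rewrite !fpowersetE sD0 -natrM mulnb; congr (_ + _%:R); congr nat_of_bool.
  have [k_in|//] := boolP (0 < k < n)%N.
  by rewrite fsubUset sD0 fsub1set mem_below k_in.
have fE G : lft k G = D -> rgt k G = E -> f G = [&& a, b,
    (k \in P) ==> (k \in xor_shift G) & (k.+1 \in P) ==> (k.+1 \in xor_shift G)].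
  by move=> eq_D eq_E; rewrite /f (xor_shift_cut k _ P_peak) eq_D eq_E.
have cut0 : lft k D0 = D /\ rgt k D0 = E.
  by have := cut_eq_glue le_kn sD0 sD sE; rewrite eqxx => /andP[/eqP-> /eqP->].
have fD0 := fE D0 cut0.1 cut0.2.
(* For a cut at an end of the word one part is empty and has norm 1, and neither [k] nor [k + 1] is
   a peak. *)
have [k_in|k_out] := boolP (0 < k < n)%N; last first.
  have kP : k \in P = false.
    by apply: contraNF k_out => /sP lt_k; clear -lt_k; lia.
  have k1P : k.+1 \in P = false.
    by apply: contraNF k_out => /sP lt_k; clear -lt_k; lia.
  rewrite fD0 kP k1P /= !andbT addr0.
  have [k0|k_gt0] := posnP k.
    rewrite k0 subn0 mul1r.
    have -> : rgt_peaks 0 P = P.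
      apply/fsetP=> i; rewrite mem_rgt_peaks addn0 andb_idl // => /sP/andP[] //.
    by rewrite mulrCA -natrM mulnb.
  have -> : k = n by clear -k_gt0 k_out le_kn; lia.
  have -> : lft n P = P.
    by apply/fsetP=> i; rewrite mem_lft andb_idr // => /sP/andP[].
  by rewrite subnn mul1r -mulrA -natrM mulnb.
have sD1 : (D1 `<=` below n)%fset by rewrite fsubUset sD0 fsub1set mem_below k_in.
have cut1 : lft k D1 = D /\ rgt k D1 = E.
  have := cut_eq_glue le_kn sD1 sD sE; rewrite -/D0 -/D1 eqxx k_in orbT.
  by move=> /andP[/eqP-> /eqP->].
rewrite fD0 (fE D1 cut1.1 cut1.2) /=.
have xk (G : {fset nat}) : (k \in xor_shift G) = ((k \in G) != (k.-1 \in G)).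
  by rewrite mem_xor_shift; case/andP: k_in => -> _.
have xk1 (G : {fset nat}) : (k.+1 \in xor_shift G) = ((k.+1 \in G) != (k \in G)).
  by rewrite mem_xor_shift.
have D1k : k \in D1 by rewrite in_fset1U eqxx.
have D1p : (k.-1 \in D1) = (k.-1 \in D0).
  by rewrite in_fset1U (_ : k.-1 == k = false) //; clear -k_in; lia.
have D1s : (k.+1 \in D1) = (k.+1 \in D0).
  by rewrite in_fset1U (_ : k.+1 == k = false) //; clear; lia.
rewrite !xk !xk1 D1k D1p D1s (negbTE k_D0).
have -> : (if n is 0 then 1 else 2%:R ^+ (#|` P|).+1 : K) = 2%:R ^+ (#|` P|).+1.
  by case: (n) k_in => // /andP[_]; rewrite ltn0.
have -> : (if k is 0 then 1 else 2%:R ^+ (#|` lft k P|).+1 : K)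
    = 2%:R ^+ (#|` lft k P|).+1 by case: (k) k_in.
have -> : (if (n - k)%N is 0 then 1 else 2%:R ^+ (#|` rgt_peaks k P|).+1 : K)
    = 2%:R ^+ (#|` rgt_peaks k P|).+1.
  by case: (n - k)%N (subn_gt0 k n) => //; case/andP: k_in => _ ->.
rewrite (card_cut k P) mulrACA -natrM mulnb -exprD.
have not_both : ~~ ((k \in P) && (k.+1 \in P)) by apply/negP => /andP[/P0/negbTE->].
set x := #|` lft k P|; set y := #|` rgt_peaks k P|.
(* If [k] or [k + 1] is a peak, exactly one gluing meets the condition there, and the lost peak
   supplies the additional exponent. If neither is a peak, both gluings count and give the missing
   factor 2. *)
case: (k \in P) (k.+1 \in P) not_both => [] [] //= _;
  rewrite ?addn0 ?addn1 ?addSn ?addnS.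
- by case: (_ \in D0); case: (a); case: (b); rewrite ?addr0 ?add0r ?mulr1 ?mulr0.
- by case: (_ \in D0); case: (a); case: (b); rewrite ?addr0 ?add0r ?mulr1 ?mulr0.
by rewrite !andbT [_ ^+ (x + y).+2]exprSr -mulrA; congr (_ * _); case: (a); case: (b);
  rewrite /= ?addr0 ?mulr0 ?mulr1.
Qed.

End Coproduct.

(** * Closure properties of spans *)

Section Span.
Variables (K : fieldType) (V : lmodType K).
Implicit Types (A : set V).

Lemma span_add A u v : span A u -> span A v -> span A (u + v).
Proof.
move=> [s [sA ->]] [t [tA ->]]; exists (s ++ t); rewrite big_cat; split=> // x.
by rewrite mem_cat => /orP[/sA|/tA].
Qed.

Lemma span_scale A a v : span A v -> span A (a *: v).
Proof.
move=> [s [sA ->]]; exists [seq (a * x.1, x.2) | x <- s]; split=> [x|].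
  by case/mapP=> y /sA Ay ->.
by rewrite big_map scaler_sumr; apply: eq_bigr => x _; rewrite scalerA.
Qed.

Lemma span0 A : span A 0.
Proof. by exists [::]; rewrite big_nil. Qed.

Lemma span_gen A v : A v -> span A v.
Proof.
move=> Av; exists [:: (1, v)]; rewrite big_seq1 scale1r; split=> // x.
by rewrite inE => /eqP->.
Qed.

Lemma span_sum A (I : Type) (r : seq I) (p : pred I) (v : I -> V) :
  (forall i, p i -> span A (v i)) -> span A (\sum_(i <- r | p i) v i).
Proof. by move=> Av; apply: big_ind => //; [exact: span0 | exact: span_add]. Qed.

Lemma lincomb_span A (I : choiceType) (b : I -> V) c :
  (forall i, span A (b i)) -> span A (lincomb c b).
Proof. by move=> Ab; apply: span_sum => i _; apply: span_scale. Qed.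

End Span.

(** * Tensor products and their bases *)

Section Tensors.
Variable K : fieldType.

Lemma ptens_linear_l (g : series K) : linear (fun f => ptens f g : series2 K).
Proof.
move=> a u v; apply/funext => m.
change ((a * u m.1 + v m.1) * g m.2 = a * (u m.1 * g m.2) + v m.1 * g m.2).
by rewrite mulrDl mulrA.
Qed.

Lemma ptens_linear_r (f : series K) : linear (ptens f : series K -> series2 K).
Proof.
move=> a u v; apply/funext => m.
change (f m.1 * (a * u m.2 + v m.2) = a * (f m.1 * u m.2) + f m.1 * v m.2).
by rewrite mulrDr mulrCA.
Qed.

Lemma tensE (phi psi : KS K) :
  tens phi psi = lincomb phi (fun s => lincomb psi (fun t => << (s, t) >>)).
Proof.
apply: eq_bigr => s _; rewrite scaler_sumr; apply: eq_bigr => t _.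
apply/malgP => x; rewrite mcoeffU !mcoeffZ mcoeffU mulrA.
by case: eqP; rewrite ?mulr1 ?mulr0.
Qed.

Lemma tens_lincomb (I J : choiceType) (b : I -> KS K) (b' : J -> KS K) c d :
  tens (lincomb c b) (lincomb d b')
    = lincomb c (fun i => lincomb d (fun j => tens (b i) (b' j))).
Proof.
rewrite tensE lincomb_lincomb; apply: eq_lincomb => i.
under eq_lincomb => s do rewrite lincomb_lincomb.
by rewrite lincomb_exchange; apply: eq_lincomb => j; rewrite tensE.
Qed.

Lemma mcoeff_tens (phi psi : KS K) s t : (tens phi psi)@_(s, t) = phi@_s * psi@_t.
Proof.
rewrite tensE mcoeff_lincomb.
under eq_lincomb => s'.
  rewrite mcoeff_lincomb.
  under eq_lincomb => t'.
    rewrite mcoeffU (_ : _ *+ _ = (s == s')%:R *: ((t == t')%:R : K^o)); last first.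
      by rewrite eq_sym xpair_eqE -mulnb -[LHS]/(_%:R) natrM.
    over.
  rewrite lincomb_gZ lincomb_delta [_ *: _]mulrC; over.
rewrite (lincomb_gZ (fun s' => (s == s')%:R : K^o) psi@_t phi) lincomb_delta.
exact: mulrC.
Qed.

(** Evaluating the second factor at [y] leaves a vanishing combination of [b]; each of its
    coordinates, as [y] varies, is a vanishing combination of [b']. *)
Lemma ptens_free (I J : choiceType) (b : I -> series K) (b' : J -> series K) :
  freeb b -> freeb b' -> freeb (fun ij : I * J => ptens (b ij.1) (b' ij.2) : series2 K).
Proof.
move=> b_free b'_free; apply: freeb_ker => d d0.
have ev1 x : linear (fun f : series K => f x : K^o) by [].
have ev2 x : linear (fun f : series2 K => f x : K^o) by [].
have d0E x y : lincomb d (fun ij => b ij.1 x * b' ij.2 y : K^o) = 0.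
  rewrite -[RHS]/((0 : series2 K) (x, y)) -d0.
  by rewrite (linear_lincomb _ _ (ev2 (x, y))).
pose e y := lincomb d (fun ij => b' ij.2 y *: (<< ij.1 >> : {malg K[I]})).
have e0 y : e y = 0.
  apply: b_free; rewrite lincomb0 /e lincomb_lincomb; apply/funext => x.
  rewrite (linear_lincomb _ _ (ev1 x)) -[RHS](d0E x y).
  by apply: (@eq_lincomb _ _ K^o) => ij; rewrite /= lincombZ lincombU [RHS]mulrC.
apply/malgP => -[i j]; rewrite mcoeff0.
pose h i := lincomb d (fun ij => (i == ij.1)%:R *: (<< ij.2 >> : {malg K[J]})).
have h0 : h i = 0.
  apply: b'_free; rewrite lincomb0 /h lincomb_lincomb; apply/funext => y.
  have := congr1 (mcoeff i) (e0 y); rewrite mcoeff0 mcoeff_lincomb => eq0.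
  apply: etrans eq0.
  rewrite (linear_lincomb _ _ (ev1 y)).
  apply: (@eq_lincomb _ _ K^o) => ij.
  rewrite /= lincombZ lincombU mcoeffZ mcoeffU eq_sym [RHS]mulrC.
  exact: erefl.
have := congr1 (mcoeff j) h0; rewrite mcoeff0 mcoeff_lincomb => <-.
rewrite -(lincomb_delta d (i, j)); apply: (@eq_lincomb _ _ K^o) => ij.
rewrite mcoeffZ mcoeffU [ij.2 == j]eq_sym -natrM mulnb.
by case: ij => i' j'; rewrite xpair_eqE.
Qed.

Lemma tens_Pi_free : freeb (fun P : peakset * peakset => tens (Pi K P.1) (Pi K P.2)).
Proof.
have [x xP] := choice peak_index_surj.
apply: (@freeb_coef _ _ _ _ (fun P => (x P.1, x P.2)) (fun=> 0%N)) => [P|P Q].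
  by rewrite mcoeff_tens !mcoeff_Pi !xP !eqxx mulr1 oner_eq0.
rewrite mcoeff_tens !mcoeff_Pi !xP -natrM mulnb => ne_PQ _.
by case: P Q ne_PQ => P1 P2 [Q1 Q2]; rewrite xpair_eqE => /negbTE /= ->.
Qed.

End Tensors.

(** * The coproduct of fundamental quasi-symmetric functions *)

Section GammaFundamental.
Variable K : fieldType.

(** [gamma] is defined by coordinates in [M], which take a default value outside [Qsym]; hence the
    hypothesis on the family. *)
Lemma gamma_lincomb (I : choiceType) (b : I -> series K) c :
  (forall i, Qsym (b i)) -> gamma (lincomb c b) = lincomb c (gamma (K := K) \o b).
Proof.
move=> Qb; have [a aP] := choice (fun i => (span_rangeP _ _).1 (Qb i)).
have -> : b = (fun i => lincomb (a i) (M K)) by apply/funext.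
rewrite -lincomb_lincomb /gamma extend_lincomb ?lincomb_lincomb; last exact: M_free.
by apply: eq_lincomb => i /=; rewrite extend_lincomb //; exact: M_free.
Qed.

Lemma F_Qsym q : Qsym (F K q).
Proof. by rewrite F_lincomb; exact: span_lincomb. Qed.

Lemma F_set_lincomb n D : (D `<=` below n)%fset ->
  F_set K n D = \sum_(r <- compositions n | (D `<=` partial_sums r)%fset) M K r.
Proof. by move=> sD; rewrite /F_set /F wsum_comp_of ?comp_ofK. Qed.

Definition cuts (r : word) :=
  [seq (take i r, drop i r) | i <- index_iota 0 (size r).+1].

(** A pair of words is a cut of one composition only, its concatenation, and can be sorted by the
    sum [k] of its first word. *)
Lemma perm_cuts n :
  perm_eq [seq p | r <- compositions n, p <- cuts r]
          [seq p | k <- index_iota 0 n.+1, p <- [seq (u, v) | u <- compositions k,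
                                            v <- compositions (n - k)]].
Proof.
have mem_cuts r p : p \in cuts r -> r = p.1 ++ p.2.
  by case/mapP=> i _ -> /=; rewrite cat_take_drop.
apply: uniq_perm.
- apply: allpairs_uniq_dep; first exact: compositions_uniq.
    move=> r _; rewrite map_inj_in_uniq ?iota_uniq // => i j.
    rewrite !mem_index_iota !ltnS /= => le_i le_j [eq_t _].
    have := congr1 size eq_t; rewrite !size_take_min.
    by move: (size r) le_i le_j => m; clear; lia.
  move=> _ _ /allpairsPdep[r [p [_ rp ->]]] /allpairsPdep[s [q [_ sq ->]]] /= eq_pq.
  by rewrite (mem_cuts _ _ rp) (mem_cuts _ _ sq) eq_pq.
- apply: allpairs_uniq_dep; first exact: iota_uniq.
    move=> k _; apply: allpairs_uniq; rewrite ?compositions_uniq //.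
    by move=> [? ?] [? ?] _ _.
  move=> _ _ /allpairsPdep[k [p [_ kp ->]]] /allpairsPdep[l [q [_ lq ->]]] /= eq_pq.
  case/allpairsP: kp eq_pq => -[u v] /= [uk _ ->].
  case/allpairsP: lq => -[u' v'] /= [ul _ ->] [eq_u eq_v].
  by move: uk ul; rewrite eq_u eq_v !mem_compositions => /eqP<- /eqP<-.
move=> [u v]; apply/allpairsPdep/allpairsPdep => /=.
  case=> r [p [rn rp eq_p]]; exists (wsum u), (u, v); split=> //.
    rewrite mem_index_iota /= ltnS; move: rn.
    rewrite mem_compositions (mem_cuts _ _ rp).
    by rewrite -eq_p wsum_cat => /eqP <-; exact: leq_addr.
  apply/allpairsP; exists (u, v); split=> //=; rewrite mem_compositions //.
  move: rn; rewrite mem_compositions (mem_cuts _ _ rp) -eq_p wsum_cat => /eqP <-.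
  by rewrite addKn.
case=> k [p [kn /allpairsP[[u' v'] /= [uk vk ->]] [-> ->]]].
exists (u' ++ v'), (u', v'); split=> //.
  move: kn uk vk; rewrite mem_index_iota !mem_compositions wsum_cat /= ltnS.
  by move=> le_kn /eqP-> /eqP->; rewrite subnKC.
apply/mapP; exists (size u'); last by rewrite take_size_cat // drop_size_cat.
by rewrite mem_index_iota size_cat /= ltnS leq_addr.
Qed.

(** After the cuts are regrouped by [k], [sub_partial_sums_cat] turns the inclusion condition into
    one for each tensor factor. *)
Lemma gamma_F_set n D : (D `<=` below n)%fset ->
  gamma (F_set K n D)
    = \sum_(k < n.+1) ptens (F_set K k (lft k D)) (F_set K (n - k) (rgt k D)).
Proof.
move=> sD; pose G (p : word * word) : series2 K := ptens (M K p.1) (M K p.2).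
transitivity (\sum_(p <- [seq p | r <- compositions n, p <- cuts r]
    | (D `<=` partial_sums (p.1 ++ p.2))%fset) G p).
  rewrite /F_set F_lincomb /gamma extend_lincomb; last exact: M_free.
  rewrite lincomb_sum wsum_comp_of // comp_ofK // [RHS]big_mkcond big_allpairs_dep.
  rewrite [LHS]big_mkcond; apply: eq_bigr => r _; rewrite lincombU /cuts big_map.
  under [RHS]eq_bigr => i _ do rewrite cat_take_drop.
  case: ifP => _; last by rewrite big1.
  by rewrite big_mkord.
rewrite big_mkcond (perm_big _ (perm_cuts n)) big_allpairs_dep.
rewrite big_mkord; apply: eq_bigr => -[k /= le_kn] _.
rewrite !F_set_lincomb ?(lft_below _ sD) ?(rgt_below _ sD) //.
have ptens_suml (r : seq word) (p : pred word) g :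
    ptens (\sum_(u <- r | p u) M K u) g = \sum_(u <- r | p u) ptens (M K u) g.
  apply: (big_morph (fun f => ptens f g : series2 K)) => [f f'|].
    by have := ptens_linear_l g 1 f f'; rewrite !scale1r.
  by apply/funext => m; exact: mul0r.
have ptens_sumr (r : seq word) (p : pred word) f :
    ptens f (\sum_(v <- r | p v) M K v) = \sum_(v <- r | p v) ptens f (M K v).
  apply: (big_morph (fun g => ptens f g : series2 K)) => [g g'|].
    by have := ptens_linear_r f 1 g g'; rewrite !scale1r.
  by apply/funext => m; exact: mulr0.
rewrite big_allpairs_dep ptens_suml [RHS]big_mkcond /=; apply: eq_big_seq => u.
rewrite mem_compositions => /eqP uk; rewrite ptens_sumr.
have [lftD|nlftD] := boolP (lft k D `<=` partial_sums u)%fset.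
  rewrite [RHS]big_mkcond; apply: eq_big_seq => v; rewrite mem_compositions => /eqP vk.
  rewrite sub_partial_sums_cat ?uk ?vk ?subnKC // lftD //.
rewrite big1_seq // => v /andP[_]; rewrite mem_compositions => /eqP vk.
by rewrite sub_partial_sums_cat ?uk ?vk ?subnKC // (negbTE nlftD).
Qed.

End GammaFundamental.

(** * The coproduct of peak functions and the dual pairing *)

Section Main.
Variable K : fieldType.

Lemma Kpeak_norm_Qsym P : Qsym (Kpeak_norm K P).
Proof. by rewrite Kpeak_norm_lincomb; apply: lincomb_span => q; apply: F_Qsym. Qed.

Lemma gammaZ (a : K) (f : series K) : Qsym f -> gamma (a *: f) = a *: gamma f.
Proof.
(* A family with one member turns scaling into an instance of [gamma_lincomb]. *)
move=> Qf; have := @gamma_lincomb K unit (fun=> f) (a *: << tt >>) (fun=> Qf).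
by rewrite !lincombZ !lincombU.
Qed.

Lemma gamma_sum (I : choiceType) (r : seq I) (p : pred I) (f : I -> series K) :
  (forall i, p i -> Qsym (f i)) ->
  gamma (\sum_(i <- r | p i) f i) = \sum_(i <- r | p i) gamma (f i).
Proof.
move=> Qf; have gamma0 : gamma (0 : series K) = 0.
  rewrite -[0 in LHS](lincomb0 (M K)) gamma_lincomb ?lincomb0 // => q.
  by apply/span_gen; exists q.
have gammaD (u v : series K) : Qsym u -> Qsym v -> gamma (u + v) = gamma u + gamma v.
  move=> Qu Qv; pose b (x : bool) := if x then u else v.
  have := @gamma_lincomb K bool b (<< true >> + << false >>).
  by rewrite !lincombD !lincombU /=; apply; case.
elim: r => [|i r IHr]; first by rewrite !big_nil.
rewrite !big_cons; case: ifP => // pi; rewrite gammaD ?IHr //; first exact: Qf.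
exact: span_sum.
Qed.

(** For each cut [k], the coefficient of a tensor of fundamental functions is the left side of
    [peak_norm_cut], whose right side is a product of coefficients of the two factors. *)
Lemma gamma_Kpeak_norm P : gamma (Kpeak_norm K P)
  = \sum_(k < (val P).1.+1)
      ptens (Kpeak_norm K (peak_lft k P)) (Kpeak_norm K (peak_rgt k P)).
Proof.
rewrite Kpeak_normE KpeakE gammaZ; last first.
  by apply: span_sum => D _; exact: F_Qsym.
rewrite gamma_sum => [|D _]; last exact: F_Qsym.
rewrite big_seq_cond.
under eq_bigr => D.
  rewrite fpowersetE => /andP[sD _]; rewrite gamma_F_set //; over.
rewrite -big_seq_cond exchange_big scaler_sumr; apply: eq_bigr => -[k /= le_kn] _.
set n := (val P).1 in le_kn *; set Q := (val P).2.
pose G (D E : {fset nat}) : series2 K := ptens (F_set K k D) (F_set K (n - k) E).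
transitivity (\sum_(D <- fpowerset (below k)) \sum_(E <- fpowerset (below (n - k)))
  (peak_norm K P * \sum_(H <- fpowerset (below n) | (Q `<=` xor_shift H)%fset)
     ((lft k H == D) && (rgt k H == E))%:R) *: G D E).
  rewrite scaler_sumr big_seq_cond.
  under eq_bigr => H.
    rewrite fpowersetE => /andP[sH _].
    rewrite (_ : ptens _ _ = \sum_(D <- fpowerset (below k))
      \sum_(E <- fpowerset (below (n - k)))
        ((lft k H == D) && (rgt k H == E))%:R *: G D E); last first.
      rewrite (bigD1_seq (lft k H)) ?fset_uniq ?fpowersetE ?(lft_below _ sH) //=.
      rewrite (bigD1_seq (rgt k H)) ?fset_uniq ?fpowersetE ?rgt_below //=.
      rewrite !eqxx scale1r !big1 ?addr0 // => [D neD|E neE].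
        by rewrite big1 // => E _; rewrite eq_sym (negbTE neD) scale0r.
      by rewrite andbC eq_sym (negbTE neE) scale0r.
    over.
  rewrite -big_seq_cond.
  under eq_bigr => H _.
    rewrite scaler_sumr; under eq_bigr => D _ do rewrite scaler_sumr; over.
  rewrite exchange_big; apply: eq_bigr => D _.
  rewrite exchange_big; apply: eq_bigr => E _.
  rewrite mulr_sumr scaler_suml; apply: eq_bigr => H _.
  by rewrite scalerA.
have KE (R : peakset) : Kpeak_norm K R = \sum_(D <- fpowerset (below (val R).1))
    (peak_norm K R * ((val R).2 `<=` xor_shift D)%fset%:R) *: F_set K (val R).1 D.
  rewrite Kpeak_normE KpeakE scaler_sumr big_mkcond; apply: eq_bigr => D _.
  by case: ifP => _; rewrite ?mulr1 // mulr0 scale0r.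
rewrite !KE /=.
have ptens_suml (r : seq {fset nat}) (c : {fset nat} -> K) f (g : series K) :
    ptens (\sum_(D <- r) c D *: f D) g
      = \sum_(D <- r) c D *: ptens (f D) g :> series2 K.
  elim: r => [|D r IHr]; first by rewrite !big_nil; apply/funext => m; exact: mul0r.
  by rewrite !big_cons ptens_linear_l IHr.
have ptens_sumr (r : seq {fset nat}) (c : {fset nat} -> K) (f : series K) g :
    ptens f (\sum_(D <- r) c D *: g D)
      = \sum_(D <- r) c D *: ptens f (g D) :> series2 K.
  elim: r => [|D r IHr]; first by rewrite !big_nil; apply/funext => m; exact: mulr0.
  by rewrite !big_cons ptens_linear_r IHr.
rewrite ptens_suml; apply: eq_big_seq => D; rewrite fpowersetE => sD.
rewrite ptens_sumr scaler_sumr; apply: eq_big_seq => E; rewrite fpowersetE => sE.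
by rewrite peak_norm_cut // scalerA.
Qed.

Hypothesis charK : [pchar K] =i pred0.

Lemma gamma_lincomb_Kpeak_norm c : gamma (lincomb c (Kpeak_norm K))
  = lincomb c (fun P => \sum_(k < (val P).1.+1)
      ptens (Kpeak_norm K (peak_lft k P)) (Kpeak_norm K (peak_rgt k P))).
Proof.
rewrite gamma_lincomb; last exact: Kpeak_norm_Qsym.
by apply: eq_lincomb => P; exact: gamma_Kpeak_norm.
Qed.

Lemma stembridge_sub_coalgebra : sub_coalgebra (stembridge : set (series K)).
Proof.
split=> f /(stembridgeP charK)[c ->].
  by apply: lincomb_span => P; exact: Kpeak_norm_Qsym.
rewrite gamma_lincomb_Kpeak_norm; apply: lincomb_span => P; apply: span_sum => k _.
have st R : stembridge (Kpeak_norm K R).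
  by apply/(stembridgeP charK); exists << R >>; rewrite lincombU.
apply: span_gen; exists (Kpeak_norm K (peak_lft k P)) => //.
by exists (Kpeak_norm K (peak_rgt k P)).
Qed.

Lemma peak_pairing_lincomb u v :
  peak_pairing (lincomb u (Pi K)) (lincomb v (Kpeak_norm K))
    = lincomb u (fun P => v@_P : K^o).
Proof.
rewrite /peak_pairing extend2_lincomb; first last.
- exact: Kpeak_norm_free.
- exact: Pi_free.
by apply: (@eq_lincomb _ _ K^o) => P; exact: lincomb_delta.
Qed.

Lemma peak_pairing_basis P Q :
  peak_pairing (Pi K P) (Kpeak_norm K Q) = (P == Q)%:R.
Proof.
by rewrite /peak_pairing extend2_basis //; [exact: Pi_free|exact: Kpeak_norm_free].
Qed.

(** Pairing with a member of the dual basis reads off a coordinate; the other side is analogous. *)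
Lemma peak_pairing_nondeg_l phi : peak_algebra phi ->
  (forall f, stembridge f -> peak_pairing phi f = 0) -> phi = 0 :> KS K.
Proof.
move=> /span_rangeP[u ->] H; suff -> : u = 0 by rewrite lincomb0.
apply/malgP => P; rewrite mcoeff0 -(H (lincomb << P >> (Kpeak_norm K))).
  rewrite peak_pairing_lincomb -lincomb_delta; apply: (@eq_lincomb _ _ K^o) => Q.
  by rewrite mcoeffU.
by apply/(stembridgeP charK); exists << P >>.
Qed.

Lemma peak_pairing_nondeg_r f : stembridge f ->
  (forall phi, peak_algebra phi -> peak_pairing phi f = 0) -> f = 0 :> series K.
Proof.
move=> /(stembridgeP charK)[v ->] H; suff -> : v = 0 by rewrite lincomb0.
apply/malgP => P; rewrite mcoeff0 -(H (lincomb << P >> (Pi K))).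
  by rewrite peak_pairing_lincomb (lincombU (fun Q => v@_Q : K^o)).
exact: span_lincomb.
Qed.

(** The coordinate of [Pi_star] at [R] is its coefficient at any word with peaks [R]: it tests
    whether [P] and [Q] are the parts of [R] at the cut given by the degree of [P]. *)
Lemma peak_pairing_Pi_star P Q v :
  peak_pairing (Pi_star K P Q) (lincomb v (Kpeak_norm K))
    = lincomb v (fun R => \sum_(k < (val R).1.+1)
        ((P == peak_lft k R) && (Q == peak_rgt k R))%:R : K^o).
Proof.
have [c cP] := Pi_star_lincomb K P Q; rewrite cP peak_pairing_lincomb.
have -> : lincomb c (fun R => v@_R : K^o) = lincomb v (fun R => c@_R : K^o).
  under eq_lincomb => R do rewrite -lincomb_delta.
  rewrite lincomb_exchange; apply: (@eq_lincomb _ _ K^o) => R.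
  under eq_lincomb => R' do rewrite eq_sym.
  exact: lincomb_delta.
apply: (@eq_lincomb _ _ K^o) => R; have [x xR] := peak_index_surj R.
have -> : c@_R = (Pi_star K P Q)@_x.
  rewrite cP mcoeff_lincomb -lincomb_delta; apply: (@eq_lincomb _ _ K^o) => R'.
  by rewrite mcoeff_Pi xR.
rewrite mcoeff_perm_sum; have := peak_indexE x R; rewrite xR eqxx.
move=> /esym/andP[/eqP eq_n /eqP eq_P]; rewrite eq_n eq_P.
have lftE k : (P == peak_lft k R) = ((val P).1 == k) && ((val P).2 == lft k (val R).2).
  by rewrite -val_eqE.
have rgtE k : (Q == peak_rgt k R) = ((val Q).1 == (val R).1 - k)%N
    && ((val Q).2 == rgt_peaks k (val R).2).
  by rewrite -val_eqE.
have [le_n|lt_n] := leqP (val P).1 (val R).1; last first.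
  rewrite (_ : _ == _ = false) /=; last first.
    by rewrite ltn_eqF // (leq_trans lt_n) // leq_addr.
  by rewrite big1 // => -[k /= le_k] _; rewrite lftE (gtn_eqF (leq_trans le_k lt_n)).
(* The degree of [peak_lft k R] is [k], so only this [k] can match [P]. *)
rewrite (bigD1 (Ordinal (le_n : ((val P).1 < (val R).1.+1)%N))) //= big1 ?addr0.
  rewrite lftE rgtE eqxx /= [(val P).2 == _]eq_sym [(val Q).2 == _]eq_sym.
  rewrite (_ : ((val R).1 == _)%N = ((val Q).1 == (val R).1 - (val P).1)%N); last first.
    by rewrite -[in LHS](subnKC le_n) eqn_add2l eq_sym.
  by rewrite andbCA.
move=> k ne_k; rewrite lftE (_ : _ == _ = false) //.
by apply: contraNF ne_k => /eqP eq_k; apply/eqP/val_inj.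
Qed.

(** Expanded in the bases, both sides are the same trilinear form: for [P], [Q] and [R] it counts
    the cuts of [R] into [P] and [Q]. *)
Lemma peak_pairing_star (phi psi : KS K) (f : series K) :
  peak_algebra phi -> peak_algebra psi -> stembridge f ->
  peak_pairing (star phi psi) f = peak_pairing2 (tens phi psi) (gamma f).
Proof.
move=> /span_rangeP[x ->] /span_rangeP[y ->] /(stembridgeP charK)[z ->].
pose tP (P : peakset * peakset) := tens (Pi K P.1) (Pi K P.2).
pose tK (P : peakset * peakset) : series2 K :=
  ptens (Kpeak_norm K P.1) (Kpeak_norm K P.2).
have -> : tens (lincomb x (Pi K)) (lincomb y (Pi K))
    = lincomb (lincomb x (fun P => lincomb y (fun Q => << (P, Q) >>))) tP.
  rewrite tens_lincomb lincomb_lincomb; apply: eq_lincomb => P.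
  by rewrite lincomb_lincomb; apply: eq_lincomb => Q; rewrite lincombU.
have -> : gamma (lincomb z (Kpeak_norm K))
    = lincomb (lincomb z (fun R => \sum_(k < (val R).1.+1)
        << (peak_lft k R, peak_rgt k R) >>)) tK.
  rewrite gamma_lincomb_Kpeak_norm lincomb_lincomb; apply: eq_lincomb => R.
  by rewrite lincomb_sum; apply: eq_bigr => k _; rewrite lincombU.
rewrite /peak_pairing2 extend2_lincomb; first last.
- by apply: ptens_free; exact: Kpeak_norm_free.
- exact: tens_Pi_free.
have [c cP] := choice (fun PQ => Pi_star_lincomb K PQ.1 PQ.2).
have -> : star (lincomb x (Pi K)) (lincomb y (Pi K))
    = lincomb (lincomb x (fun P => lincomb y (fun Q => c (P, Q)))) (Pi K).
  rewrite star_Pi_lincomb lincomb_lincomb; apply: eq_lincomb => P.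
  by rewrite lincomb_lincomb; apply: eq_lincomb => Q; exact: (cP (P, Q)).
rewrite peak_pairing_lincomb !lincomb_lincomb; apply: (@eq_lincomb _ _ K^o) => P.
rewrite !lincomb_lincomb; apply: (@eq_lincomb _ _ K^o) => Q.
rewrite -peak_pairing_lincomb -(cP (P, Q)) peak_pairing_Pi_star lincombU.
rewrite lincomb_lincomb; apply: (@eq_lincomb _ _ K^o) => R.
rewrite lincomb_sum; apply: eq_bigr => k _.
by rewrite lincombU !peak_pairing_basis -natrM mulnb.
Qed.

End Main.

Theorem corollary5p6 (K : fieldType) (charK : [pchar K] =i pred0) :
  [/\ ker_iota = stembridge_perp :> set (KS K),
      sub_coalgebra (stembridge : set (series K)),
      [/\ forall phi psi : KS K,
             peak_algebra phi -> peak_algebra psi -> peak_algebra (star phi psi),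
          forall phi : KS K, peak_algebra phi ->
             (forall f, stembridge f -> peak_pairing phi f = 0) -> phi = 0
        & forall f : series K, stembridge f ->
             (forall phi, peak_algebra phi -> peak_pairing phi f = 0) -> f = 0]
    & forall (phi psi : KS K) (f : series K),
        peak_algebra phi -> peak_algebra psi -> stembridge f ->
        peak_pairing (star phi psi) f = peak_pairing2 (tens phi psi) (gamma f)].
Proof.
split; [exact: ker_iotaE | exact: stembridge_sub_coalgebra | split|].
- exact: peak_algebra_star.
- exact: peak_pairing_nondeg_l.
- exact: peak_pairing_nondeg_r.
- exact: peak_pairing_star.
Qed.
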